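(* Let $n,m$ be positive even integers and let $\mathcal C$ be a subgroup of $C_n\times C_m\subset SO(2)\times SO(2)$ with two generators which falls into class $\mathrm E_1$. Then $\mathcal C$ is a direct product of two cyclic groups (in a non-unique way), and a possible choice is $$\mathcal C=\mathcal C_1\times\mathcal C_2,$$ $$\mathcal C_1=\left\{\left(R\left(\left(\tfrac{2\pi}{n}\mathcal A_1\right)i_1\right),R\left(\left(\tfrac{2\pi}{m}\mathcal B_1\right)i_1\right)\right):\ i_1\in\{0,1,\dots,|\mathcal C_1|-1\}\right\},$$ $$\mathcal C_2=\left\{\left(R\left(\left(\tfrac{2\pi}{n}\mathcal A_2\right)i_2\right),R\left(\left(\tfrac{2\pi}{m}\mathcal B_2\right)i_2\right)\right):\ i_2\in\{0,1,\dots,|\mathcal C_2|-1\}\right\},$$ where, for some values of the parameters in the ranges specified in the context, $$|\mathcal C_1|=\prod_{i=1}^{N_8}p_i^{k_i},\qquad|\mathcal C_2|=\prod_{i=N_4+1}^{N_8}p_i^{l_i},$$ and, with $\sum_{(q)}$ denoting the sum over $N_{q-1}<i\le N_q$, $$\mathcal A_1=\sum_{(1)}r_ip_i^{a_i-k_i}\tfrac{n}{p_i^{a_i}}+\sum_{(2)}p_i^{a_i-k_i}\tfrac{n}{p_i^{a_i}}+\sum_{(3)}j_i\tfrac{n}{p_i^{a_i}}+\sum_{(4)}p_i^{a_i-k_i}\tfrac{n}{p_i^{a_i}}+\sum_{(5)}r_ip_i^{a_i-k_i}\tfrac{n}{p_i^{a_i}}+\sum_{(6)}p_i^{a_i-k_i}\tfrac{n}{p_i^{a_i}}+\sum_{(7)}t_i\tfrac{n}{p_i^{a_i}}+\sum_{(8)}p_i^{a_i-k_i}\tfrac{n}{p_i^{a_i}},$$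 $$\mathcal B_1=\sum_{(1)}p_i^{b_i-k_i}\tfrac{m}{p_i^{b_i}}+\sum_{(2)}\rho_ip_i^{b_i-k_i+1}\tfrac{m}{p_i^{b_i}}+\sum_{(3)}p_i^{b_i-k_i}\tfrac{m}{p_i^{b_i}}+\sum_{(4)}j_i\tfrac{m}{p_i^{b_i}}+\sum_{(5)}p_i^{b_i-k_i}\tfrac{m}{p_i^{b_i}}+\sum_{(6)}\rho_ip_i^{b_i-k_i+1}\tfrac{m}{p_i^{b_i}}+\sum_{(7)}p_i^{b_i-k_i}\tfrac{m}{p_i^{b_i}}+\sum_{(8)}t_i\tfrac{m}{p_i^{b_i}},$$ $$\mathcal A_2=\sum_{(5)}p_i^{a_i-l_i}\tfrac{n}{p_i^{a_i}}+\sum_{(7)}p_i^{a_i-l_i}\tfrac{n}{p_i^{a_i}},\qquad \mathcal B_2=\sum_{(6)}p_i^{b_i-l_i}\tfrac{m}{p_i^{b_i}}+\sum_{(8)}p_i^{b_i-l_i}\tfrac{m}{p_i^{b_i}}.$$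
   Context: $R(\theta)=\begin{pmatrix}\cos\theta&\sin\theta\\-\sin\theta&\cos\theta\end{pmatrix}$; $C_N=\{R(2\pi r/N):0\le r\le N-1\}\subset SO(2)$. Products are internal direct products. A group ''with two generators'' means a group that can be generated by two elements but is not cyclic. Class $\mathrm E_1$: subgroups of $C_n\times C_m$ containing $(-I,-I)$ but not containing the whole group $\{(I,I),(-I,I),(I,-I),(-I,-I)\}$. Write $n=2^{\alpha_1}\mathrm p_2^{\alpha_2}\cdots\mathrm p_s^{\alpha_s}$, $m=2^{\beta_1}\mathrm p_2^{\beta_2}\cdots\mathrm p_s^{\beta_s}$ with $\mathrm p_1=2$, $\mathrm p_2,\dots,\mathrm p_s$ distinct odd primes, $\alpha_1,\beta_1\ge1$, $\alpha_i,\beta_i\ge0$ for $i\ge2$. Block indices: $N_0=0$, $N_1=\nu$, $N_2=\nu+\chi$, $N_3=\nu+\chi+\tau$, $N_4=\nu+\chi+\tau+\psi$, $N_5=N_4+\sigma$, $N_6=N_5+\theta$, $N_7=N_6+\phi$, $N_8=N_7+\xi$. Parameter ranges ($k_i,l_i$ are non-negative integers; empty sums are $0$): - $\nu,\chi,\tau,\psi,\sigma,\theta,\phi,\xi$ are non-negative integers with sum at most $s$, and $(p_i^{a_i},p_i^{b_i})$, $i=1,\dots,s$, is a permutation of the $s$ pairs $(\mathrm p_i^{\alpha_i},\mathrm p_i^{\beta_i})$; - $0<i\le N_1$: one of the primes $p_1,\dots,p_\nu$ is $2$; if $p_t=2$ then $1\le k_t\le\min(a_t,b_t)$ and $r_t\in\{1,\dots,2^{k_t}-1\}\setminus\{2,2\cdot2,\dots,(2^{k_t-1}-1)2\}$;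 for the other such $i$, $k_i\le\min(a_i,b_i)$ and $r_i\in\{0,\dots,p_i^{k_i}-1\}$; - $N_1<i\le N_2$: $1\le k_i\le\min(a_i,b_i)$, $\rho_i\in\{0,\dots,p_i^{k_i-1}-1\}$; - $N_2<i\le N_3$: $a_i<k_i\le b_i$, $j_i\in\{0,\dots,p_i^{a_i}-1\}$; - $N_3<i\le N_4$: $b_i<k_i\le a_i$, $j_i\in\{0,\dots,p_i^{b_i}-1\}$; - $N_4<i\le N_5$: $1\le l_i\le k_i\le\min(a_i,b_i)$, $r_i\in\{0,\dots,p_i^{k_i-l_i}-1\}$; - $N_5<i\le N_6$: $1\le l_i<k_i\le\min(a_i,b_i)$, $\rho_i\in\{0,\dots,p_i^{k_i-l_i-1}-1\}$; - $N_6<i\le N_7$: $1\le l_i\le a_i<k_i\le b_i$, $t_i\in\{0,\dots,p_i^{a_i-l_i}-1\}$; - $N_7<i\le N_8$: $1\le l_i\le b_i<k_i\le a_i$, $t_i\in\{0,\dots,p_i^{b_i-l_i}-1\}$. Some or all of the exponents $a_i,b_i$ with $i\le N_4$, $i\neq t$, may be zero, while $a_ib_i\neq0$ for at least one $i$ with $N_4<i\le N_8$. *)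

(* Defs.v *)
From mathcomp Require Import all_boot all_order all_fingroup all_algebra.
From mathcomp Require Import all_classical all_reals all_analysis.

Set Implicit Arguments.
Unset Strict Implicit.
Unset Printing Implicit Defensive.

Import Order.TTheory GRing.Theory Num.Theory.

Local Open Scope classical_set_scope.
Local Open Scope ring_scope.

(* Groups are subgroups of the group of units of a ring.  For SO(2) x SO(2) the
   ring is the product ring 'M[R]_2 * 'M[R]_2, whose operations are
   componentwise. *)
Record is_subgroup (U : unitRingType) (H : set U) : Prop := IsSubgroup {
  subgroup_unit : forall x, H x -> x \is a GRing.unit;
  subgroup_1 : H 1;
  subgroup_M : forall x y, H x -> H y -> H (x * y);
  subgroup_V : forall x, H x -> H x^-1
}.

Definition gen_subgroup (U : unitRingType) (S : set U) : set U :=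
  smallest (@is_subgroup U) S.

Definition cyclic_group (U : unitRingType) (H : set U) : Prop :=
  is_subgroup H /\ exists x, H x /\ H = gen_subgroup [set x].

Definition two_generators (U : unitRingType) (H : set U) : Prop :=
  (exists x y, [/\ H x, H y & H = gen_subgroup [set x; y]]) /\ ~ cyclic_group H.

Record internal_direct_product (U : unitRingType) (H H1 H2 : set U) : Prop :=
  InternalDirectProduct {
    idp_subgroup1 : is_subgroup H1;
    idp_subgroup2 : is_subgroup H2;
    idp_commute : forall x y, H1 x -> H2 y -> x * y = y * x;
    idp_disjoint : H1 `&` H2 = [set 1];
    idp_product : H = [set z | exists x y, [/\ H1 x, H2 y & z = x * y]]
  }.

Definition rotmx (R : realType) (x : R) : 'M[R]_2 :=
  \matrix_(i, j) if i == j then cos x else if (i < j)%N then sin x else - sin x.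

Definition rotation_group (R : realType) (N : nat) : set 'M[R]_2 :=
  [set rotmx (2 * pi * r%:R / N%:R) | r in `I_N].
Arguments rotation_group : clear implicits.

Definition klein_four (R : realType) : set ('M[R]_2 * 'M[R]_2) :=
  [set (1, 1); (- 1, 1); (1, - 1); (- 1, - 1)].
Arguments klein_four : clear implicits.

Record class_E1 (R : realType) (n m : nat) (C : set ('M[R]_2 * 'M[R]_2)) :
    Prop := ClassE1 {
  E1_subgroup : is_subgroup C;
  E1_sub : C `<=` rotation_group R n `*` rotation_group R m;
  E1_center : C (- 1, - 1);
  E1_klein : ~ klein_four R `<=` C
}.

Local Open Scope nat_scope.

(* All lists indexed by 1, ..., s are indexed here by 'I_s, that is from 0. *)
Record factorization (n m : nat) : Type := Factorization {
  fs : nat;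
  fs_gt0 : 0 < fs;
  fprime : 'I_fs -> nat;
  falpha : 'I_fs -> nat;
  fbeta : 'I_fs -> nat;
  fprime_prime : forall i, prime (fprime i);
  fprime_inj : injective fprime;
  fprime_2 : fprime (Ordinal fs_gt0) = 2;
  falpha_gt0 : 0 < falpha (Ordinal fs_gt0);
  fbeta_gt0 : 0 < fbeta (Ordinal fs_gt0);
  falphaE : n = \prod_(i < fs) fprime i ^ falpha i;
  fbetaE : m = \prod_(i < fs) fprime i ^ fbeta i
}.

(* [ptt] is the family t_i of the last two blocks; it is unrelated to the index
   t of the prime 2. *)
Record params (n m : nat) (F : factorization n m) : Type := Params {
  pnu : nat; pchi : nat; ptau : nat; ppsi : nat;
  psigma : nat; ptheta : nat; pphi : nat; pxi : nat;
  pperm : {perm 'I_(fs F)};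
  pk : 'I_(fs F) -> nat;
  pl : 'I_(fs F) -> nat;
  pr : 'I_(fs F) -> nat;
  prho : 'I_(fs F) -> nat;
  pj : 'I_(fs F) -> nat;
  ptt : 'I_(fs F) -> nat
}.

Definition pp n m (F : factorization n m) (q : params F) (i : 'I_(fs F)) : nat :=
  fprime (pperm q i).
Definition pa n m (F : factorization n m) (q : params F) (i : 'I_(fs F)) : nat :=
  falpha (pperm q i).
Definition pb n m (F : factorization n m) (q : params F) (i : 'I_(fs F)) : nat :=
  fbeta (pperm q i).

Definition N1 n m (F : factorization n m) (q : params F) : nat := pnu q.
Definition N2 n m (F : factorization n m) (q : params F) : nat := N1 q + pchi q.
Definition N3 n m (F : factorization n m) (q : params F) : nat := N2 q + ptau q.
Definition N4 n m (F : factorization n m) (q : params F) : nat := N3 q + ppsi q.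
Definition N5 n m (F : factorization n m) (q : params F) : nat := N4 q + psigma q.
Definition N6 n m (F : factorization n m) (q : params F) : nat := N5 q + ptheta q.
Definition N7 n m (F : factorization n m) (q : params F) : nat := N6 q + pphi q.
Definition N8 n m (F : factorization n m) (q : params F) : nat := N7 q + pxi q.

(* In each block the exponents subtracted below are at most those they
   are subtracted from, so truncated subtraction is harmless. *)
Record admissible n m (F : factorization n m) (q : params F) : Prop :=
  Admissible {
  adm_size : N8 q <= fs F;
  adm_two : exists t : 'I_(fs F), t < N1 q /\ pp q t = 2;
  adm_1two : forall i : 'I_(fs F), i < N1 q -> pp q i = 2 ->
    [/\ 1 <= pk q i <= minn (pa q i) (pb q i),
        1 <= pr q i <= 2 ^ pk q i - 1 &
        forall c, 1 <= c <= 2 ^ (pk q i - 1) - 1 -> pr q i <> c * 2];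
  adm_1odd : forall i : 'I_(fs F), i < N1 q -> pp q i <> 2 ->
    pk q i <= minn (pa q i) (pb q i) /\ pr q i <= pp q i ^ pk q i - 1;
  adm_2 : forall i : 'I_(fs F), N1 q <= i < N2 q ->
    1 <= pk q i <= minn (pa q i) (pb q i) /\
    prho q i <= pp q i ^ (pk q i - 1) - 1;
  adm_3 : forall i : 'I_(fs F), N2 q <= i < N3 q ->
    pa q i < pk q i <= pb q i /\ pj q i <= pp q i ^ pa q i - 1;
  adm_4 : forall i : 'I_(fs F), N3 q <= i < N4 q ->
    pb q i < pk q i <= pa q i /\ pj q i <= pp q i ^ pb q i - 1;
  adm_5 : forall i : 'I_(fs F), N4 q <= i < N5 q ->
    1 <= pl q i <= pk q i /\ pk q i <= minn (pa q i) (pb q i) /\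
    pr q i <= pp q i ^ (pk q i - pl q i) - 1;
  adm_6 : forall i : 'I_(fs F), N5 q <= i < N6 q ->
    1 <= pl q i < pk q i /\ pk q i <= minn (pa q i) (pb q i) /\
    prho q i <= pp q i ^ (pk q i - pl q i - 1) - 1;
  adm_7 : forall i : 'I_(fs F), N6 q <= i < N7 q ->
    1 <= pl q i <= pa q i /\ pa q i < pk q i <= pb q i /\
    ptt q i <= pp q i ^ (pa q i - pl q i) - 1;
  adm_8 : forall i : 'I_(fs F), N7 q <= i < N8 q ->
    1 <= pl q i <= pb q i /\ pb q i < pk q i <= pa q i /\
    ptt q i <= pp q i ^ (pb q i - pl q i) - 1;
  adm_rank2 : exists i : 'I_(fs F), N4 q <= i < N8 q /\ pa q i * pb q i <> 0
}.

Definition card_C1 n m (F : factorization n m) (q : params F) : nat :=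
  \prod_(i < fs F | i < N8 q) pp q i ^ pk q i.
Definition card_C2 n m (F : factorization n m) (q : params F) : nat :=
  \prod_(i < fs F | N4 q <= i < N8 q) pp q i ^ pl q i.

(* n / p_i^a_i and m / p_i^b_i; both divisions are exact. *)
Definition cofn n m (F : factorization n m) (q : params F) (i : 'I_(fs F)) : nat :=
  n %/ pp q i ^ pa q i.
Definition cofm n m (F : factorization n m) (q : params F) (i : 'I_(fs F)) : nat :=
  m %/ pp q i ^ pb q i.

Definition calA1 n m (F : factorization n m) (q : params F) : nat :=
    \sum_(i < fs F | i < N1 q) pr q i * pp q i ^ (pa q i - pk q i) * cofn q i
  + \sum_(i < fs F | N1 q <= i < N2 q) pp q i ^ (pa q i - pk q i) * cofn q i
  + \sum_(i < fs F | N2 q <= i < N3 q) pj q i * cofn q i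
  + \sum_(i < fs F | N3 q <= i < N4 q) pp q i ^ (pa q i - pk q i) * cofn q i
  + \sum_(i < fs F | N4 q <= i < N5 q)
      pr q i * pp q i ^ (pa q i - pk q i) * cofn q i
  + \sum_(i < fs F | N5 q <= i < N6 q) pp q i ^ (pa q i - pk q i) * cofn q i
  + \sum_(i < fs F | N6 q <= i < N7 q) ptt q i * cofn q i
  + \sum_(i < fs F | N7 q <= i < N8 q) pp q i ^ (pa q i - pk q i) * cofn q i.

Definition calB1 n m (F : factorization n m) (q : params F) : nat :=
    \sum_(i < fs F | i < N1 q) pp q i ^ (pb q i - pk q i) * cofm q i
  + \sum_(i < fs F | N1 q <= i < N2 q)
      prho q i * pp q i ^ (pb q i - pk q i + 1) * cofm q i
  + \sum_(i < fs F | N2 q <= i < N3 q) pp q i ^ (pb q i - pk q i) * cofm q i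
  + \sum_(i < fs F | N3 q <= i < N4 q) pj q i * cofm q i
  + \sum_(i < fs F | N4 q <= i < N5 q) pp q i ^ (pb q i - pk q i) * cofm q i
  + \sum_(i < fs F | N5 q <= i < N6 q)
      prho q i * pp q i ^ (pb q i - pk q i + 1) * cofm q i
  + \sum_(i < fs F | N6 q <= i < N7 q) pp q i ^ (pb q i - pk q i) * cofm q i
  + \sum_(i < fs F | N7 q <= i < N8 q) ptt q i * cofm q i.

Definition calA2 n m (F : factorization n m) (q : params F) : nat :=
    \sum_(i < fs F | N4 q <= i < N5 q) pp q i ^ (pa q i - pl q i) * cofn q i
  + \sum_(i < fs F | N6 q <= i < N7 q) pp q i ^ (pa q i - pl q i) * cofn q i.

Definition calB2 n m (F : factorization n m) (q : params F) : nat :=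
    \sum_(i < fs F | N5 q <= i < N6 q) pp q i ^ (pb q i - pl q i) * cofm q i
  + \sum_(i < fs F | N7 q <= i < N8 q) pp q i ^ (pb q i - pl q i) * cofm q i.

Local Open Scope ring_scope.

Definition rot_powers (R : realType) (n m A B N : nat) :
    set ('M[R]_2 * 'M[R]_2) :=
  [set (rotmx (2 * pi / n%:R * A%:R * i%:R), rotmx (2 * pi / m%:R * B%:R * i%:R))
    | i in `I_N].
Arguments rot_powers : clear implicits.

(* Main.v *)
Require Import Defs.
From mathcomp Require Import all_boot all_order all_fingroup all_algebra.
From mathcomp Require Import all_classical all_reals all_analysis.
From mathcomp Require Import cyclic unstable zify ring lra.

(** The pair of rotations by 2 pi x / n and 2 pi y / m is written torus (x, y).
The map torus is a homomorphism from Z^2 with kernel nZ x mZ, so C is the image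
of the lattice H of the (x, y) with torus (x, y) in C, which contains nZ x mZ,
and the theorem is a statement about a basis of H modulo nZ x mZ.

At a prime p, with a and b its exponents in n and m, consider the lattice of the
(x, y) such that (x n/p^a, y m/p^b) lies in H.  It contains p^a Z x p^b Z, so
its projections to the two axes are p^(a-k1) Z and p^(b-k2) Z for some k1 and
k2.  If k1 <= k2, a Hermite basis consists of a vector (x0, p^(b-k2)) and of the
generator (p^(a-l), 0) of the intersection with the first axis; here x0 matters
only modulo p^(a-l), and the size of the projection forces a power of p to
divide it.  If k2 < k1, the axes exchange their roles.  Which of k1 and k2 is
the larger, whether this larger exponent fits under the exponent of the other
axis, and whether l is zero: these three binary choices are the eight blocks of
parameters (local_classification).  At the prime 2 the lattice contains the
element that maps to (-I, -I) but neither of those that map to (-I, I) and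
(I, -I), which leaves only the first block, with r odd (block_at_two).

The local bases are glued by the Chinese remainder theorem: the vectors
(A_1, B_1) and (A_2, B_2), sums of local vectors scaled by n/p^a and m/p^b, span
H modulo nZ x mZ (subgroup_glue), and a combination of them with coefficients
c and d vanishes exactly when |C_1| divides c and |C_2| divides d (glue_dvd,
block_independent).  So C is the direct product of the two cyclic groups that
they generate.  The group C is not cyclic, so |C_2| > 1; as |C_2| divides |C_1|,
adding the second generator to the first one yields a different decomposition
(cyc_decomposition).  The order of the primes demanded by the block indices is
obtained by sorting them by block (sorting_perm, block_params_admissible). *)

(** * Subgroups of abelian groups, given by predicates *)

Section Lattices.
Set Implicit Arguments. Unset Strict Implicit.
Import Order.TTheory GRing.Theory Num.Theory.
Local Open Scope ring_scope.

Definition subgroup_pred (V : zmodType) (S : V -> Prop) : Prop :=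
  S 0 /\ forall x y, S x -> S y -> S (x - y).

Section SubgroupPred.
Variables (V : zmodType) (S : V -> Prop).
Hypothesis sgS : subgroup_pred S.

Lemma subgroup_pred0 : S 0. Proof. by case: sgS. Qed.

Lemma subgroup_predB x y : S x -> S y -> S (x - y).
Proof. by case: sgS => _; apply. Qed.

Lemma subgroup_predN x : S x -> S (- x).
Proof. by rewrite -sub0r; apply: subgroup_predB; apply: subgroup_pred0. Qed.

Lemma subgroup_predD x y : S x -> S y -> S (x + y).
Proof. by move=> Sx Sy; rewrite -[y]opprK; apply/subgroup_predB/subgroup_predN. Qed.

Lemma subgroup_predMz x (c : int) : S x -> S (x *~ c).
Proof.
move=> Sx; have SxMn (k : nat) : S (x *+ k).
  elim: k => [|k IHk]; first exact: subgroup_pred0.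
  by rewrite mulrS; apply: subgroup_predD.
by case: c => k; [exact: SxMn | apply: subgroup_predN; exact: (SxMn k.+1)].
Qed.

Lemma subgroup_pred_sum (I : Type) (r : seq I) (G : I -> V) :
  (forall i, S (G i)) -> S (\sum_(i <- r) G i).
Proof.
move=> SG; elim: r => [|i r IHr]; first by rewrite big_nil; apply: subgroup_pred0.
by rewrite big_cons; apply: subgroup_predD.
Qed.

End SubgroupPred.

Lemma mulr_pairz (x y c : int) : ((x, y) : int * int) *~ c = (c * x, c * y).
Proof.
have mulrn_pair (k : nat) : ((x, y) : int * int) *+ k = (x *+ k, y *+ k).
  by elim: k => // k IHk; rewrite !mulrS IHk.
case: c => k; first by rewrite -pmulrn mulrn_pair !pmulrn !mulrzz mulrC [y * _]mulrC.
rewrite NegzE mulrNz -pmulrn mulrn_pair !pmulrn !mulrzz.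
by rewrite !mulNr [_ * x]mulrC [_ * y]mulrC.
Qed.

Lemma subgroup_pred_pairM (S : int * int -> Prop) (c x y : int) :
  subgroup_pred S -> S (x, y) -> S (c * x, c * y).
Proof. by move=> sgS Sxy; rewrite -mulr_pairz; apply: subgroup_predMz. Qed.

(** * Lattices at one prime *)

(** A subgroup of Z that contains a power of p is generated by a power of p,
since by Bezout the gcd of p^a and any of its members is a member. *)
Lemma subgroup_pred_pow (p a : nat) (S : int -> Prop) :
    prime p -> subgroup_pred S -> S (p ^ a)%N ->
  exists2 k, (k <= a)%N & forall x, S x <-> ((p ^ (a - k))%N %| x)%Z.
Proof.
move=> p_pr sgS Sa.
have exe : exists e, `[< S (p ^ e)%N >] by exists a; apply/asboolP.
case: (ex_minnP exe) => e /asboolP Se emin.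
have lea : (e <= a)%N by apply: emin; apply/asboolP.
exists (a - e)%N; first by rewrite leq_subr.
rewrite subKn // =>  x; split=> [Sx|/dvdzP[c ->]]; last first.
  by rewrite mulrC -mulrzz; apply: subgroup_predMz.
have [u [v Euv]] := Bezoutz x (p ^ a)%N.
have Sg : S (gcdz x (p ^ a)%N).
  rewrite -Euv; apply: subgroup_predD => //;
  by rewrite mulrC -mulrzz; apply: subgroup_predMz.
have := dvdz_gcdr x (p ^ a)%N.
have [g Eg] : exists g : nat, gcdz x (p ^ a)%N = g by rewrite /gcdz; eexists.
rewrite Eg in Sg *; rewrite dvdzE /= => /(dvdn_pfactor _ _ p_pr)[f lefa Ef].
rewrite Ef in Sg Eg; have lef : (e <= f)%N by apply: emin; apply/asboolP.
apply: dvdz_trans (dvdz_gcdl x (p ^ a)%N); rewrite Eg dvdzE /=.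
by apply: dvdn_exp2l.
Qed.

(** Four subgroups of Z are attached to a lattice: its two projections and its
intersections with the two axes.  Each is generated by a power of p, and an
intersection lies in the projection to the same axis. *)
Lemma hermite_form (p a b : nat) (H : int * int -> Prop) :
    prime p -> subgroup_pred H -> H ((p ^ a)%N : int, 0) -> H (0, (p ^ b)%N : int) ->
  exists k1 k2 l1 l2,
    [/\ (l1 <= k1 <= a)%N /\ (l2 <= k2 <= b)%N,
        forall x, (exists y, H (x, y)) <-> ((p ^ (a - k1))%N %| x)%Z,
        forall y, (exists x, H (x, y)) <-> ((p ^ (b - k2))%N %| y)%Z,
        forall x, H (x, 0) <-> ((p ^ (a - l1))%N %| x)%Z &
        forall y, H (0, y) <-> ((p ^ (b - l2))%N %| y)%Z].
Proof.
move=> p_pr sgH Ha Hb.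
have [k1 le1 H1]: exists2 k, (k <= a)%N &
    forall x, (exists y, H (x, y)) <-> ((p ^ (a - k))%N %| x)%Z.
  apply: subgroup_pred_pow => //; last by exists 0.
  split; first by exists 0; exact: (subgroup_pred0 sgH).
  by move=> x x' [y Hy] [y' Hy']; exists (y - y'); apply: (subgroup_predB sgH Hy Hy').
have [k2 le2 H2]: exists2 k, (k <= b)%N &
    forall y, (exists x, H (x, y)) <-> ((p ^ (b - k))%N %| y)%Z.
  apply: subgroup_pred_pow => //; last by exists 0.
  split; first by exists 0; exact: (subgroup_pred0 sgH).
  by move=> y y' [x Hx] [x' Hx']; exists (x - x'); apply: (subgroup_predB sgH Hx Hx').
have [l1 lel1 H3]: exists2 l, (l <= a)%N &
    forall x, H (x, 0) <-> ((p ^ (a - l))%N %| x)%Z.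
  apply: subgroup_pred_pow => //.
  split; first exact: (subgroup_pred0 sgH).
  by move=> x x' Hy Hy'; rewrite -[0](subr0 0); apply: (subgroup_predB sgH Hy Hy').
have [l2 lel2 H4]: exists2 l, (l <= b)%N &
    forall y, H (0, y) <-> ((p ^ (b - l))%N %| y)%Z.
  apply: subgroup_pred_pow => //.
  split; first exact: (subgroup_pred0 sgH).
  by move=> x x' Hy Hy'; rewrite -[0](subr0 0); apply: (subgroup_predB sgH Hy Hy').
have p_gt1 := prime_gt1 p_pr.
exists k1, k2, l1, l2; split=> //; rewrite le1 le2 !andbT; split.
  have /H1 : exists y, H ((p ^ (a - l1))%N : int, y) by exists 0; apply/H3; exact: dvdzz.
  by rewrite dvdzE /= dvdn_Pexp2l //; lia.
have /H2 : exists x, H (x, (p ^ (b - l2))%N : int) by exists 0; apply/H4; exact: dvdzz.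
by rewrite dvdzE /= dvdn_Pexp2l //; lia.
Qed.

(** The Hermite basis: a vector whose second coordinate generates the second
projection, together with a generator of the intersection with the first axis.
When l = 0 that generator is p^a, which vanishes modulo p^a; the value 0 is then
used instead, because the second generator of a cyclic component is absent from
the sums A_2 and B_2. *)
Lemma hermite_span (p a b k l : nat) (X : int) (H : int * int -> Prop) :
    subgroup_pred H -> H ((p ^ a)%N : int, 0) -> H (0, (p ^ b)%N : int) ->
    (forall x y, H (x, y) -> ((p ^ (b - k))%N %| y)%Z) ->
    (forall x, H (x, 0) <-> ((p ^ (a - l))%N %| x)%Z) ->
    H (X, (p ^ (b - k))%N : int) ->
  forall x y, H (x, y) <-> exists c d : int,
    ((p ^ a)%N %| x - (c * X + d * (if l == 0 then 0 else p ^ (a - l))%N))%Z /\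
    ((p ^ b)%N %| y - c * (p ^ (b - k))%N)%Z.
Proof.
move=> sgH Ha Hb Hk Hl HX x y; split=> [Hxy|[c [d [/dvdzP[u Eu] /dvdzP[v Ev]]]]].
  have /dvdzP[c Ec] := Hk _ _ Hxy; have HcX := subgroup_pred_pairM c sgH HX.
  have := subgroup_predB sgH Hxy HcX; rewrite /= -Ec.
  rewrite [X in H X](_ : _ = (x - c * X, 0)); last by congr pair; rewrite /= subrr.
  case/Hl/dvdzP=> d Ed; exists c, d; rewrite -Ec subrr opprD addrA Ed.
  split; last exact: dvdz0.
  have [->|_] := eqVneq l 0%N; last by rewrite subrr dvdz0.
  by rewrite subn0 mulr0 subr0; exact: dvdz_mull.
set Y := (if l == 0 then _ else _)%N in Eu.
have HY : H (Y : int, 0).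
  by rewrite /Y; case: eqP => _; [exact: (subgroup_pred0 sgH)|apply/Hl; exact: dvdzz].
have -> : (x, y) = (c * X, c * (p ^ (b - k))%N) + (d * Y, d * 0)
   + ((u * (p ^ a)%N, u * 0) + (v * 0, v * (p ^ b)%N)) :> (int * int)%type.
  by congr pair => /=; [move: Eu|move: Ev]; lia.
by apply: subgroup_predD => //; apply: subgroup_predD => //;
  apply: subgroup_pred_pairM => //; apply/Hl.
Qed.

(** The first vector of the Hermite basis can be normalized: its first coordinate
lies in the first projection, hence is a multiple of p^g, and it can be reduced
modulo the intersection with the first axis.  The two cases to be covered are
gap = 0, for k1 <= k, and gap = 1, for k1 < k, where one more factor p comes
out if k <= a; it is the +1 in the exponents of the second and sixth blocks. *)
Lemma hermite_reduce (p a b gap k1 k l : nat) (x0 : int) (H : int * int -> Prop) :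
    prime p -> subgroup_pred H ->
    (l <= k1 <= a)%N -> (k1 + gap <= k)%N ->
    (forall x, (exists y, H (x, y)) <-> ((p ^ (a - k1))%N %| x)%Z) ->
    (forall x, H (x, 0) <-> ((p ^ (a - l))%N %| x)%Z) ->
    H (x0, (p ^ (b - k))%N : int) ->
  let g := if (k <= a)%N then (a - k + gap)%N else 0%N in
  exists2 w : nat, (w < p ^ (a - l - g))%N &
    H ((w * p ^ g)%N : int, (p ^ (b - k))%N : int).
Proof.
move=> p_pr sgH /andP[le1f lefa] le12 H1 H3 Hx0 g.
have p_gt0 := prime_gt0 p_pr.
have le_g_e1 : (g <= a - k1)%N by rewrite /g; case: ifP; lia.
have : ((p ^ g)%N %| x0)%Z.
  have /H1 : exists y, H (x0, y) by exists (p ^ (b - k))%N.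
  by apply: dvdz_trans; rewrite dvdzE /=; apply: dvdn_exp2l.
case/dvdzP=> z Ez; pose q := (p ^ (a - l - g))%N.
have q_gt0 : (0 < q)%N by rewrite expn_gt0 p_gt0.
have w_ge0 : 0 <= (z %% q)%Z by apply: modz_ge0; lia.
exists `|(z %% q)%Z|%N.
  have := ltz_mod z (_ : (q : int) != 0).
  by move=> /(_ ltac:(lia)); rewrite -/q; lia.
have Ew : (`|(z %% q)%Z|%N * p ^ g)%N%:Z = x0 - (z %/ q)%Z * (p ^ (a - l))%N.
  have -> : (p ^ (a - l) = q * p ^ g)%N by rewrite -expnD; congr (_ ^ _)%N; lia.
  rewrite !PoszM Ez gez0_abs //.
  rewrite mulrA -mulrBl; congr (_ * _); have := divz_eq z q; lia.
rewrite Ew.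
rewrite (_ : (_, _) = (x0, (p ^ (b - k))%N : int) -
    ((z %/ q)%Z * (p ^ (a - l))%N, 0) :> (int * int)%type).
  by apply: subgroup_predB => //; apply/H3; exact: dvdz_mull.
by congr pair; rewrite /= subr0.
Qed.

(** The local contributions to A_1, B_1, A_2, B_2 in block bl + 1, before scaling
by the cofactors; w stands for whichever of r, rho, j, t the block uses.  For
bl < 4, the blocks bl and bl + 4 have the same first vector: the former has l = 0
and the latter l > 0. *)
Definition blockA1 (p a k w bl : nat) : nat :=
  match bl with
  | 0 | 4 => w * p ^ (a - k)
  | 2 | 6 => w
  | _ => p ^ (a - k)
  end%N.

Definition blockB1 (p b k w bl : nat) : nat :=
  match bl with
  | 1 | 5 => w * p ^ (b - k + 1)
  | 3 | 7 => w
  | _ => p ^ (b - k)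
  end%N.

Definition blockA2 (p a l bl : nat) : nat :=
  match bl with 4 | 6 => p ^ (a - l) | _ => 0 end%N.

Definition blockB2 (p b l bl : nat) : nat :=
  match bl with 5 | 7 => p ^ (b - l) | _ => 0 end%N.

Definition block_ok (p a b k l w bl : nat) : Prop :=
  match bl with
  | 0 => [/\ k <= minn a b, w < p ^ k & l = 0]
  | 1 => [/\ 1 <= k <= minn a b, w < p ^ (k - 1) & l = 0]
  | 2 => [/\ a < k <= b, w < p ^ a & l = 0]
  | 3 => [/\ b < k <= a, w < p ^ b & l = 0]
  | 4 => [/\ 1 <= l <= k, k <= minn a b & w < p ^ (k - l)]
  | 5 => [/\ 1 <= l < k, k <= minn a b & w < p ^ (k - l - 1)]
  | 6 => [/\ 1 <= l <= a, a < k <= b & w < p ^ (a - l)]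
  | 7 => [/\ 1 <= l <= b, b < k <= a & w < p ^ (b - l)]
  | _ => False
  end%N.

(** The case k1 <= k2 gives the blocks of even index and the other case, which is
the first one with the axes exchanged, those of odd index. *)
Lemma local_classification (p a b : nat) (H : int * int -> Prop) :
    prime p -> subgroup_pred H -> H ((p ^ a)%N : int, 0) -> H (0, (p ^ b)%N : int) ->
  exists bl k l w, block_ok p a b k l w bl /\
    forall x y, H (x, y) <-> exists c d : int,
      ((p ^ a)%N %| x - (c * blockA1 p a k w bl + d * blockA2 p a l bl))%Z /\
      ((p ^ b)%N %| y - (c * blockB1 p b k w bl + d * blockB2 p b l bl))%Z.
Proof.
move=> p_pr sgH Ha Hb.
have [k1 [k2 [l1 [l2 [[lel1 lel2] H1 H2 H3 H4]]]]] := hermite_form p_pr sgH Ha Hb.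
have [le12|lt21] := leqP k1 k2.
- have [x0 Hx0] : exists x, H (x, (p ^ (b - k2))%N : int) by apply/H2; exact: dvdzz.
  have := @hermite_reduce p a b 0 k1 k2 l1 x0 H p_pr sgH lel1.
  rewrite !addn0 => /(_ le12 H1 H3 Hx0) /=[w lt_w Hw].
  have Hk x y : H (x, y) -> ((p ^ (b - k2))%N %| y)%Z by move=> Hxy; apply/H2; exists x.
  have spanH := hermite_span sgH Ha Hb Hk H3 Hw.
  exists ((if k2 <= a then 0 else 2) + (if l1 == 0 then 0 else 4))%N, k2, l1, w.
  split.
    move: lt_w; have [leka|ltak] := leqP k2 a;
      have [El0|l_neq0] := eqVneq l1 0%N; rewrite /= => lt_w; split; try lia;
      by move: lt_w; congr (_ < _ ^ _)%N; lia.
  move=> x y; apply: (iff_trans (spanH x y)).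
  by case: (k2 <= a)%N; case: (l1 == 0)%N => /=; split=> -[c [d [Dx Dy]]];
    exists c, d; move: Dx Dy; rewrite /= ?muln1 ?mulr0 ?addr0.
- pose H' z := H (z.2, z.1); have [y0 Hy0] : exists y, H' (y, (p ^ (a - k1))%N : int).
    by apply/H1; exact: dvdzz.
  have sgH' : subgroup_pred H'.
    split=> [|[y x] [y' x'] Hxy Hxy']; first exact: (subgroup_pred0 sgH).
    exact: (subgroup_predB sgH Hxy Hxy').
  have := @hermite_reduce p b a 1 k2 k1 l2 y0 H' p_pr sgH' lel2.
  rewrite !addn1 => /(_ lt21 H2 H4 Hy0) /=[w lt_w Hw].
  have Hk y x : H' (y, x) -> ((p ^ (a - k1))%N %| x)%Z by move=> Hxy; apply/H1; exists y.
  have spanH := hermite_span sgH' Hb Ha Hk H4 Hw.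
  exists ((if k1 <= b then 1 else 3) + (if l2 == 0 then 0 else 4))%N, k1, l2, w.
  split.
    move: lt_w; have [leka|ltak] := leqP k1 b;
      have [El0|l_neq0] := eqVneq l2 0%N; rewrite /= => lt_w; split; try lia;
      by move: lt_w; congr (_ < _ ^ _)%N; lia.
  move=> x y; apply: (iff_trans (spanH y x)).
  by case: (k1 <= b)%N; case: (l2 == 0)%N => /=; split=> -[c [d [Dx Dy]]];
    exists c, d; move: Dx Dy; rewrite /= ?addn1 ?muln1 ?mulr0 ?addr0.
Qed.

Lemma dvdz_pow_pexp (p a k : nat) (c : int) : (0 < p)%N -> (k <= a)%N ->
  ((p ^ a)%N %| c * (p ^ (a - k))%N)%Z = ((p ^ k)%N %| c)%Z.
Proof.
move=> p_gt0 leka.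
rewrite (_ : (p ^ a = p ^ k * p ^ (a - k))%N); last by rewrite -expnD subnKC.
rewrite PoszM dvdz_mul2r //.
by rewrite -lt0n expn_gt0 p_gt0.
Qed.

(** Relations between the two vectors of a Hermite basis: the second coordinate
alone decides divisibility of c, and then the first one that of d. *)
Lemma triangular_independent (p a b k l X Y : nat) (c d : int) :
    (0 < p)%N -> (k <= b)%N -> (l <= a)%N -> (p ^ a %| p ^ k * X)%N ->
    Y = (if l == 0 then 0 else p ^ (a - l))%N ->
  ((p ^ a)%N %| c * X + d * Y)%Z /\ ((p ^ b)%N %| c * (p ^ (b - k))%N + d * 0%N)%Z <->
  ((p ^ k)%N %| c)%Z /\ ((p ^ l)%N %| d)%Z.
Proof.
move=> p_gt0 lekb lela dvdX EY; rewrite mulr0 addr0 (dvdz_pow_pexp c p_gt0 lekb).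
have dvdY : ((p ^ a)%N %| d * Y)%Z = ((p ^ l)%N %| d)%Z.
  rewrite EY; case: (eqVneq l 0%N) => [->|_]; last exact: dvdz_pow_pexp.
  by rewrite mulr0 dvdz0 expn0 dvd1z.
have dvdcX : ((p ^ k)%N %| c)%Z -> ((p ^ a)%N %| c * X)%Z.
  case/dvdzP=> u ->; rewrite -mulrA dvdz_mull //.
by split=> -[D1 D2]; split=> //; move: D1 D2; rewrite -dvdY;
  [move=> D /dvdcX Dc; rewrite (rpredDl _ Dc) in D | move=> /dvdcX Dc D; rewrite rpredD].
Qed.

Lemma block_independent (p a b k l w bl : nat) (c d : int) :
    prime p -> block_ok p a b k l w bl ->
  ((p ^ a)%N %| c * blockA1 p a k w bl + d * blockA2 p a l bl)%Z /\
  ((p ^ b)%N %| c * blockB1 p b k w bl + d * blockB2 p b l bl)%Z <->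
  ((p ^ k)%N %| c)%Z /\ ((p ^ l)%N %| d)%Z.
Proof.
move=> p_pr; have p_gt0 := prime_gt0 p_pr.
have dvd_small v e k' : (e <= k' -> p ^ e %| p ^ k' * v)%N.
  by move=> le_ek; rewrite dvdn_mulr // dvdn_exp2l.
have dvd_big v e k' : (k' <= e -> p ^ e %| p ^ k' * (v * p ^ (e - k')))%N.
  by move=> le_ke; rewrite mulnCA -expnD subnKC // dvdn_mull.
have dvd_big1 v e k' : (k' <= e -> p ^ e %| p ^ k' * (v * p ^ (e - k' + 1)))%N.
  by move=> le_ke; rewrite mulnCA -expnD dvdn_mull // dvdn_exp2l //; lia.
have eqY l' e : (0 < l')%N -> (p ^ (e - l') = if l' == 0 then 0 else p ^ (e - l'))%N.
  by case: l'.
case: bl => [|[|[|[|[|[|[|[|]]]]]]]] //= [ok1 ok2 ok3];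
  first [apply: triangular_independent => //
        |rewrite and_comm; apply: triangular_independent => //];
    first [lia | apply: dvd_big; lia | apply: dvd_big1; lia | apply: dvd_small; lia
    | by rewrite ok3 | apply: eqY; lia].
Qed.

(** The 2-part of a group of class E_1 is cyclic, and its involution is
nontrivial in both coordinates.  If l > 0, or in the blocks 2, 3 and 4, a
multiple of one of the generators is an involution with a trivial coordinate;
in the first block this occurs when w is even, while k = 0 leaves no
involution at all. *)
Lemma block_at_two (a b k l w bl : nat) (H : int * int -> Prop) :
    (0 < a)%N -> (0 < b)%N -> block_ok 2 a b k l w bl ->
    subgroup_pred H -> H ((2 ^ a)%N : int, 0) -> H (0, (2 ^ b)%N : int) ->
    (forall x y, H (x, y) <-> exists c d : int,
      ((2 ^ a)%N %| x - (c * blockA1 2 a k w bl + d * blockA2 2 a l bl))%Z /\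
      ((2 ^ b)%N %| y - (c * blockB1 2 b k w bl + d * blockB2 2 b l bl))%Z) ->
    H ((2 ^ (a - 1))%N : int, (2 ^ (b - 1))%N : int) ->
    ~ H ((2 ^ (a - 1))%N : int, 0) -> ~ H (0, (2 ^ (b - 1))%N : int) ->
  [/\ bl = 0, 0 < k & odd w]%N.
Proof.
move=> a_gt0 b_gt0 ok sgH Ha Hb spanH Hhalf Hhalfa Hhalfb.
have drop_fst u y : H ((u * 2 ^ a)%N : int, y : int) -> H (0, y).
  move=> Huy; have := subgroup_predB sgH Huy (subgroup_pred_pairM u sgH Ha).
  by congr H; congr pair; rewrite /= ?mulr0 ?subr0 // PoszM subrr.
have drop_snd u x : H (x : int, (u * 2 ^ b)%N : int) -> H (x, 0).
  move=> Hxu; have := subgroup_predB sgH Hxu (subgroup_pred_pairM u sgH Hb).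
  by congr H; congr pair; rewrite /= ?mulr0 ?subr0 // PoszM subrr.
have H1 (c : nat) : H ((c * blockA1 2 a k w bl)%N : int, (c * blockB1 2 b k w bl)%N : int).
  by apply/spanH; exists c, 0; rewrite !mul0r !addr0 !PoszM !subrr !dvdz0.
have H2 (c : nat) : H ((c * blockA2 2 a l bl)%N : int, (c * blockB2 2 b l bl)%N : int).
  by apply/spanH; exists 0, c; rewrite !mul0r !add0r !PoszM !subrr !dvdz0.
(* These three identities evaluate 2^(f-1) times an entry of a generator. *)
have pow_half e f : (0 < f <= e)%N -> (2 ^ (f - 1) * 2 ^ (e - f) = 2 ^ (e - 1))%N.
  by move=> le_fe; rewrite -expnD; congr (_ ^ _)%N; lia.
have pow_ge u e f : (e <= f - 1)%N -> (2 ^ (f - 1) * u = 2 ^ (f - 1 - e) * u * 2 ^ e)%N.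
  by move=> le_ef; rewrite -mulnA [(u * _)%N]mulnC mulnA -expnD subnK.
have pow_half1 u e f : (0 < f <= e)%N -> (2 ^ (f - 1) * (u * 2 ^ (e - f + 1)) = u * 2 ^ e)%N.
  by move=> le_fe; rewrite mulnCA -expnD; congr (_ * _ ^ _)%N; lia.
have := H1 (2 ^ (k - 1))%N; have := H2 (2 ^ (l - 1))%N.
case: bl ok {H1 H2} spanH => [|[|[|[|[|[|[|[|]]]]]]]] //= [ok1 ok2 ok3] spanH G2 G1.
- case: k => [|k] in ok1 ok2 spanH G1 *.
    have w0 : w = 0%N by lia.
    case/spanH: Hhalf => c [d []]; rewrite w0 mul0n !mulr0 addr0 subr0 => /dvdn_leq.
    by rewrite expn_gt0 leq_exp2l //; lia.
  case: (boolP (odd w)) => // w_even; case: Hhalfb.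
  apply: (@drop_fst w./2); move: G1; rewrite pow_half; last by lia.
  congr (H (Posz _, Posz _)); rewrite mulnCA pow_half; last by lia.
  rewrite -{1}(even_halfK w_even) -muln2 -mulnA -expnS; congr (_ * _ ^ _)%N; lia.
- by case: Hhalfa; apply: (@drop_snd w); move: G1; rewrite pow_half ?pow_half1 //; lia.
- case: Hhalfb; move: G1; rewrite pow_half; last by lia.
  by rewrite (pow_ge _ a); [apply: drop_fst | lia].
- case: Hhalfa; move: G1; rewrite pow_half; last by lia.
  by rewrite (pow_ge _ b); [apply: drop_snd | lia].
- by case: Hhalfa; move: G2; rewrite muln0 pow_half //; lia.
- by case: Hhalfb; move: G2; rewrite muln0 pow_half //; lia.
- by case: Hhalfa; move: G2; rewrite muln0 pow_half //; lia.
- by case: Hhalfb; move: G2; rewrite muln0 pow_half //; lia.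
Qed.

(** * Gluing over the primes *)

Lemma coprime_big_prodr (I : Type) (r : seq I) (P : pred I) (G : I -> nat) (x : nat) :
  (forall i, P i -> coprime x (G i)) -> coprime x (\prod_(i <- r | P i) G i).
Proof.
move=> coG; apply: (big_ind (fun y => coprime x y)); first exact: coprimen1.
  by move=> y z; rewrite coprimeMr => -> ->.
exact: coG.
Qed.

Section Gluing.
Variables (I : finType) (p : I -> nat).
Hypothesis p_prime : forall i, prime (p i).
Hypothesis p_inj : injective p.

Local Notation ppow e := (\prod_i p i ^ e i)%N.

Definition cofactor (e : I -> nat) (i : I) : nat := (ppow e %/ p i ^ e i)%N.

Lemma cofactorE e i : cofactor e i = (\prod_(j | j != i) p j ^ e j)%N.
Proof. by rewrite /cofactor (bigD1 i) //= mulKn // expn_gt0 prime_gt0. Qed.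

Lemma cofactorK e i : (cofactor e i * p i ^ e i)%N = ppow e.
Proof. by rewrite cofactorE mulnC [RHS](bigD1 i). Qed.

Lemma dvd_cofactor e i j : j != i -> (p j ^ e j %| cofactor e i)%N.
Proof. by move=> neq_ji; rewrite cofactorE (bigD1 j) //= dvdn_mulr. Qed.

Lemma coprime_cofactor e f i : coprime (p i ^ f) (cofactor e i).
Proof.
rewrite cofactorE; apply: coprime_big_prodr => j neq_ji.
apply: coprimeXl; apply: coprimeXr; rewrite prime_coprime // dvdn_prime2 //.
by apply: contraNneq neq_ji => /p_inj->.
Qed.

Lemma dvdz_ppow e (z : int) :
  (ppow e %| z)%Z <-> forall i, ((p i ^ e i)%N %| z)%Z.
Proof.
split=> [dvd_z i|dvd_z].
  by apply: dvdz_trans dvd_z; rewrite dvdzE /= -(cofactorK e i) dvdn_mull.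
rewrite dvdzE /=; apply/Gauss_dvd_prod => [|i _ _]; last exact: dvd_z.
rewrite pairwise_map filter_predT.
have := index_enum_uniq I; rewrite uniq_pairwise; apply: sub_pairwise => i j neq_ij.
apply: coprimeXl; apply: coprimeXr; rewrite prime_coprime // dvdn_prime2 //.
by apply: contraNneq neq_ij => /p_inj->.
Qed.

Lemma glue_coord e (x : I -> nat) i :
  ((p i ^ e i)%N %| ((\sum_j x j * cofactor e j)%N : int) - ((x i * cofactor e i)%N : int))%Z.
Proof.
rewrite (bigD1 i) //= PoszD addrC addKr dvdzE /=; apply: dvdn_sum => j neq_ji.
by rewrite dvdn_mull // dvd_cofactor // eq_sym.
Qed.

(** Modulo p_i^(e_i) only the term of index i of a glued sum survives, and its
cofactor is invertible there. *)
Lemma glue_dvd e (x1 x2 : I -> nat) (c d : int) :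
  (ppow e %| c * (\sum_j x1 j * cofactor e j)%N + d * (\sum_j x2 j * cofactor e j)%N)%Z
  <-> forall i, ((p i ^ e i)%N %| c * x1 i + d * x2 i)%Z.
Proof.
suff eq_dvd i : ((p i ^ e i)%N %|
    c * (\sum_j x1 j * cofactor e j)%N + d * (\sum_j x2 j * cofactor e j)%N)%Z =
    ((p i ^ e i)%N %| c * x1 i + d * x2 i)%Z.
  split=> [/dvdz_ppow dvd_z i|dvd_z]; first by rewrite -eq_dvd.
  by apply/dvdz_ppow=> i; rewrite eq_dvd.
have dvd_diff := rpredD (dvdz_mull c (glue_coord e x1 i)) (dvdz_mull d (glue_coord e x2 i)).
rewrite -[RHS](Gauss_dvdzl _ (_ : coprimez _ (cofactor e i))); last first.
  by rewrite coprimezE coprime_cofactor.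
rewrite -[LHS](rpredBr _ dvd_diff); congr (_ %| _)%Z; rewrite !PoszM; ring.
Qed.

(** One coordinate of the spanning property: if c and d solve the local congruences
simultaneously, then they solve the global one.  The local ones hold for the
multiple E_i x = u_i n_i x, with n_i the cofactor, which is x modulo p_i^(e_i). *)
Lemma glue_span e (x1 x2 : I -> nat) (c d : int) (cc dd u E : I -> int) (x : int) :
    (forall i, ((p i ^ e i)%N %| c - cc i)%Z) ->
    (forall i, ((p i ^ e i)%N %| d - dd i)%Z) ->
    (forall i, ((p i ^ e i)%N %| E i - 1)%Z) ->
    (forall i, E i = u i * cofactor e i) ->
    (forall i, ((p i ^ e i)%N %| u i * x - (cc i * x1 i + dd i * x2 i))%Z) ->
  (ppow e %| x - (c * (\sum_j x1 j * cofactor e j)%N +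
                  d * (\sum_j x2 j * cofactor e j)%N))%Z.
Proof.
move=> Hc Hd HE Eu Hx; apply/dvdz_ppow=> i.
have dvd_diff := rpredD (dvdz_mull c (glue_coord e x1 i)) (dvdz_mull d (glue_coord e x2 i)).
set A1 := Posz (\sum_j _)%N in dvd_diff *; set A2 := Posz (\sum_j _)%N in dvd_diff *.
have -> : x - (c * A1 + d * A2) = - (x * (E i - 1)) +
   (u i * x - (cc i * x1 i + dd i * x2 i)) * cofactor e i
   - (c - cc i) * Posz (x1 i * cofactor e i) - (d - dd i) * Posz (x2 i * cofactor e i)
   - (c * (A1 - Posz (x1 i * cofactor e i)) + d * (A2 - Posz (x2 i * cofactor e i))).
  by rewrite Eu !PoszM; ring.
rewrite rpredB // rpredB ?rpredB ?rpredD ?rpredN //;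
 by [apply: dvdz_mull | apply: dvdz_mulr].
Qed.

(** Idempotents of the Chinese remainder theorem: by Euler, a power of a cofactor
is 1 modulo the complementary prime power. *)
Lemma idempotents (e : I -> nat) : exists E : I -> nat, forall i,
   ((p i ^ e i)%N %| (E i : int) - 1)%Z /\ (cofactor e i %| E i)%N.
Proof.
exists (fun i => cofactor e i ^ totient (p i ^ e i))%N => i.
have pe_gt0 : (0 < p i ^ e i)%N by rewrite expn_gt0 prime_gt0.
split; last by apply: dvdn_exp; rewrite ?totient_gt0.
have co_cof : coprime (cofactor e i) (p i ^ e i) by rewrite coprime_sym coprime_cofactor.
have cof_gt0 : (0 < cofactor e i)%N.
  by rewrite cofactorE prodn_gt0 // => j; rewrite expn_gt0 prime_gt0.
rewrite subzn ?expn_gt0 ?cof_gt0 // dvdzE /= -eqn_mod_dvd ?expn_gt0 ?cof_gt0 //.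
by apply/eqP; apply: Euler_exp_totient.
Qed.

Lemma dvdn_cofactor e f i : (forall j, e j <= f j)%N -> (cofactor e i %| cofactor f i)%N.
Proof.
move=> le_ef; rewrite !cofactorE.
by apply: (big_ind2 (fun x y => x %| y)%N) => // *; [apply: dvdn_mul | apply: dvdn_exp2l].
Qed.

(** Multiplication by the idempotent E_i maps the lattice into its component at
p_i, where the local spanning property applies; the local coefficients are
then combined by the same idempotents.  The idempotents are taken for the
exponents a + b so as to serve both coordinates. *)
Lemma subgroup_glue (a b x1 x2 y1 y2 : I -> nat) (H : int * int -> Prop) :
    subgroup_pred H -> H (Posz (ppow a), 0) -> H (0, Posz (ppow b)) ->
    (forall i (x y : int), H (x * cofactor a i, y * cofactor b i) <->
      exists c d : int, ((p i ^ a i)%N %| x - (c * x1 i + d * x2 i))%Z /\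
                        ((p i ^ b i)%N %| y - (c * y1 i + d * y2 i))%Z) ->
  forall x y, H (x, y) <-> exists c d : int,
    (ppow a %| x - (c * (\sum_i x1 i * cofactor a i)%N +
                    d * (\sum_i x2 i * cofactor a i)%N))%Z /\
    (ppow b %| y - (c * (\sum_i y1 i * cofactor b i)%N +
                    d * (\sum_i y2 i * cofactor b i)%N))%Z.
Proof.
move=> sgH Ha Hb local_span x y.
have glued (u v : I -> nat) :
    (forall i, H (Posz (u i * cofactor a i), Posz (v i * cofactor b i))) ->
    H (Posz (\sum_i u i * cofactor a i), Posz (\sum_i v i * cofactor b i)).
  move=> Huv.
  rewrite (_ : (_, _) = \sum_i (Posz (u i * cofactor a i),
                               Posz (v i * cofactor b i)) :> (int * int)%type).
    exact: subgroup_pred_sum.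
  by elim/big_rec3: _ => // i n1 n2 n3 _ <-.
have H1 : H (Posz (\sum_i x1 i * cofactor a i), Posz (\sum_i y1 i * cofactor b i)).
  by apply: glued => i; rewrite !PoszM; apply/local_span; exists 1, 0;
    rewrite !mul1r !mul0r !addr0 !subrr !dvdz0.
have H2 : H (Posz (\sum_i x2 i * cofactor a i), Posz (\sum_i y2 i * cofactor b i)).
  by apply: glued => i; rewrite !PoszM; apply/local_span; exists 0, 1;
    rewrite !mul1r !mul0r !add0r !subrr !dvdz0.
split=> [Hxy|[c [d [/dvdzP[u Eu] /dvdzP[v Ev]]]]]; last first.
  have := subgroup_predD sgH (subgroup_predD sgH (subgroup_pred_pairM c sgH H1)
     (subgroup_pred_pairM d sgH H2))
   (subgroup_predD sgH (subgroup_pred_pairM u sgH Ha) (subgroup_pred_pairM v sgH Hb)).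
  congr H; congr pair => /=; [move: Eu|move: Ev]; rewrite !mulr0 ?addr0 ?add0r => /eqP;
  by rewrite subr_eq addrC => /eqP.
have [E EP] := idempotents (fun i => a i + b i)%N.
have Ea i : ((p i ^ a i)%N %| (E i : int) - 1)%Z.
  by case: (EP i) => + _; apply: dvdz_trans; rewrite dvdzE /= dvdn_exp2l ?leq_addr.
have Eb i : ((p i ^ b i)%N %| (E i : int) - 1)%Z.
  by case: (EP i) => + _; apply: dvdz_trans; rewrite dvdzE /= dvdn_exp2l ?leq_addl.
have /choice[u Eu] i : exists u : nat, E i = (u * cofactor a i)%N.
  by apply/dvdnP; case: (EP i) => _; apply: dvdn_trans;
    apply: dvdn_cofactor => j; rewrite leq_addr.
have /choice[v Ev] i : exists v : nat, E i = (v * cofactor b i)%N.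
  by apply/dvdnP; case: (EP i) => _; apply: dvdn_trans;
    apply: dvdn_cofactor => j; rewrite leq_addl.
have /choice[cd Hcd] i : exists cd : int * int,
   ((p i ^ a i)%N %| Posz (u i) * x - (cd.1 * x1 i + cd.2 * x2 i))%Z /\
   ((p i ^ b i)%N %| Posz (v i) * y - (cd.1 * y1 i + cd.2 * y2 i))%Z.
  have /local_span[c [d cdP]] :
      H (Posz (u i) * x * cofactor a i, Posz (v i) * y * cofactor b i).
    have := subgroup_pred_pairM (E i) sgH Hxy.
    by congr H; congr pair; [rewrite Eu | rewrite Ev]; rewrite PoszM mulrAC.
  by exists (c, d).
pose c := \sum_i Posz (E i) * (cd i).1; pose d := \sum_i Posz (E i) * (cd i).2.
have crt (G : I -> int) i : ((p i ^ (a i + b i))%N %| \sum_j Posz (E j) * G j - G i)%Z.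
  rewrite (bigD1 i) //= addrAC -[X in _ - X]mul1r -mulrBl rpredD //.
    by apply: dvdz_mulr; case: (EP i).
  apply: rpred_sum => j neq_ji; apply: dvdz_mulr; case: (EP j) => _; rewrite dvdzE /=.
  by apply: dvdn_trans; rewrite dvd_cofactor // eq_sym.
have crta G i : ((p i ^ a i)%N %| \sum_j Posz (E j) * G j - G i)%Z.
  by apply: dvdz_trans (crt G i); rewrite dvdzE /= dvdn_exp2l ?leq_addr.
have crtb G i : ((p i ^ b i)%N %| \sum_j Posz (E j) * G j - G i)%Z.
  by apply: dvdz_trans (crt G i); rewrite dvdzE /= dvdn_exp2l ?leq_addl.
exists c, d; split.
  apply: (@glue_span _ _ _ c d (fun i => (cd i).1) (fun i => (cd i).2) u
    (fun i => E i)) => // i.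
  - exact: (crta (fun j => (cd j).1)).
  - exact: (crta (fun j => (cd j).2)).
  - by rewrite Eu PoszM.
  - by case: (Hcd i).
apply: (@glue_span _ _ _ c d (fun i => (cd i).1) (fun i => (cd i).2) v
    (fun i => E i)) => // i.
- exact: (crtb (fun j => (cd j).1)).
- exact: (crtb (fun j => (cd j).2)).
- by rewrite Ev PoszM.
- by case: (Hcd i).
Qed.

End Gluing.

End Lattices.

(** * Ordering the primes by block *)

Section Sorting.
Set Implicit Arguments.
Local Open Scope nat_scope.

Lemma ltn_count_sorted (r : seq nat) (c i : nat) :
  sorted leq r -> i < size r -> (i < count (fun x => x < c) r) = (nth 0 r i < c).
Proof.
elim: r i => //= x r IHr i x_le_r.
have r_sorted := path_sorted x_le_r.
have /allP r_ge : all (leq x) r by apply: order_path_min x_le_r; exact: leq_trans.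
have [lt_xc|le_cx] := ltnP x c.
  by case: i => [|i] //=; rewrite ltnS => lt_ir; rewrite add1n ltnS IHr.
rewrite add0n => lt_ir.
have -> : count (fun y => y < c) r = 0.
  apply/eqP; rewrite -leqn0 leqNgt -has_count; apply/hasPn => y /r_ge le_xy.
  by rewrite -leqNgt (leq_trans le_cx).
case: i lt_ir => [|i] /=; rewrite ltnS => lt_ir; first by rewrite [RHS]ltnNge le_cx.
by rewrite [RHS]ltnNge (leq_trans le_cx) // r_ge // mem_nth.
Qed.

(** Sorting by f makes each sublevel set of f an initial segment, so that block
membership can be read off the position. *)
Lemma sorting_perm (s : nat) (f : 'I_s -> nat) :
  exists g : {perm 'I_s}, forall (i : 'I_s) c, (i < #|[pred j | f j < c]|) = (f (g i) < c).
Proof.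
pose t := sort (fun i j => f i <= f j) (enum 'I_s).
have szt : size t = s by rewrite size_sort size_enum_ord.
have t_inj : injective (fun i : 'I_s => nth i t i).
  move=> i j /eqP; rewrite (set_nth_default j) ?szt //.
  by rewrite nth_uniq ?szt ?sort_uniq ?enum_uniq // => /eqP/val_inj.
exists (perm t_inj) => i c; rewrite permE.
have t_sorted : sorted leq [seq f j | j <- t].
  by rewrite sorted_map; apply: sort_sorted => x y; exact: leq_total.
rewrite -(nth_map i 0) ?szt // -ltn_count_sorted ?size_map ?szt //.
rewrite count_map; congr (_ < _).
rewrite cardE size_filter -enumT.
by apply/esym/seq.permP; rewrite perm_sort.
Qed.

End Sorting.

(** * Rotations *)

Section Rotation.
Set Implicit Arguments. Unset Strict Implicit.
Import Order.TTheory GRing.Theory Num.Theory.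
Local Open Scope classical_set_scope.
Local Open Scope card_scope.
Local Open Scope ring_scope.
Variable R : realType.

Lemma rotmxD (x y : R) : rotmx (x + y) = rotmx x * rotmx y.
Proof.
apply/matrixP=> i j; rewrite !mxE !big_ord_recl big_ord0 addr0 !mxE sinD cosD.
case: i j => [[|[|//]] ?] [[|[|//]] ?]; rewrite /= /eq_op /=; lra.
Qed.

Lemma rotmx0 : rotmx (0 : R) = 1.
Proof.
apply/matrixP=> i j; rewrite !mxE sin0 cos0.
by case: i j => [[|[|//]] ?] [[|[|//]] ?]; rewrite /= /eq_op /= ?oppr0.
Qed.

Lemma rotmx_pi : rotmx (pi : R) = - 1.
Proof.
apply/matrixP=> i j; rewrite !mxE sinpi cospi.
by case: i j => [[|[|//]] ?] [[|[|//]] ?]; rewrite /= /eq_op /= ?oppr0.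
Qed.

Lemma cos_eq1 (x : R) : 0 <= x < 2 * pi -> cos x = 1 -> x = 0.
Proof.
move=> /andP[x_ge0 x_lt]; have -> : x = x / 2 + x / 2 by lra.
rewrite cosD -!expr2 cos2sin2 => cos1.
have sin0' : sin (x / 2) ^+ 2 = 0 by lra.
have := sin0'; move/eqP; rewrite sqrf_eq0 => /eqP sin0.
have [->|x_neq0] := eqVneq x 0; first by lra.
have := @sin_gt0_pi R (x / 2); rewrite sin0 ltxx => H.
by have : false; [apply: H; rewrite lt_neqAle eq_sym; apply/andP; split; lra|].
Qed.

Definition rotz (N : nat) (x : int) : 'M[R]_2 := rotmx (2 * pi * x%:~R / N%:R).

Lemma rotzD N x y : rotz N (x + y) = rotz N x * rotz N y.
Proof. by rewrite -rotmxD /rotz intrD; congr rotmx; ring. Qed.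

Lemma rotz0 N : rotz N 0 = 1.
Proof. by rewrite /rotz mulr0 mul0r rotmx0. Qed.

Lemma rotz_eq1 N x : (0 < N)%N -> rotz N x = 1 <-> (N %| x)%Z.
Proof.
move=> N_gt0; have N_neq0 : N%:R != 0 :> R by rewrite pnatr_eq0 -lt0n.
have rotzN (q : int) : rotz N (q * N) = 1.
  have rotzMn (k : nat) : rotz N (k%:Z * N) = 1.
    elim: k => [|k IHk]; first by rewrite mul0r rotz0.
    rewrite intS mulrDl rotzD IHk mul1r mulr1 /rotz -pmulrn mulfK //.
    rewrite -rotmx0; apply/matrixP=> i j.
    by rewrite !mxE mulrC mulr_natr cos2pi sin2pi cos0 sin0.
  case: q => k; first exact: rotzMn.
  have := rotzD N (Negz k * N) (k.+1%:Z * N); rewrite -mulrDl NegzE addNr mul0r rotz0.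
  by rewrite rotzMn mulr1.
split=> [|/dvdzP[q ->]]; last exact: rotzN.
rewrite {1}(divz_eq x N) rotzD rotzN mul1r => /(congr1 (fun M : 'M[R]_2 => M 0 0)).
rewrite !mxE /= => cos1.
have r_ge0 : 0 <= (x %% N)%Z by apply: modz_ge0; lia.
have r_lt : (x %% N)%Z < N by apply: ltz_pmod; lia.
have pi0 := pi_gt0 R.
have N_gt0' : 0 < N%:R :> R by rewrite ltr0n.
have /cos_eq1 : 0 <= 2 * pi * (x %% N)%Z%:~R / (N%:R : R) < 2 * pi.
  rewrite divr_ge0 ?mulr_ge0 ?ler0z ?ler0n ?pi_ge0 //=.
  rewrite ltr_pdivrMr // ltr_pM2l ?mulr_gt0 //.
  by rewrite (pmulrn (1:R) N) ltr_int.
move=> /(_ cos1) /eqP; rewrite !mulf_eq0 invr_eq0 (negbTE N_neq0) orbF.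
rewrite pnatr_eq0 (gt_eqF pi0) /= intr_eq0 => /eqP x0.
by apply/dvdz_mod0P.
Qed.

Section Torus.
Variables n m : nat.
Hypotheses (n_gt0 : (0 < n)%N) (m_gt0 : (0 < m)%N).

Definition torus (z : int * int) : 'M[R]_2 * 'M[R]_2 := (rotz n z.1, rotz m z.2).

Lemma torusD z w : torus (z + w) = torus z * torus w.
Proof. by rewrite /torus !rotzD. Qed.

Lemma torus0 : torus 0 = 1.
Proof. by rewrite /torus !rotz0. Qed.

Lemma torus_eq1 z : torus z = 1 <-> (n %| z.1)%Z /\ (m %| z.2)%Z.
Proof.
rewrite /torus; split=> [[/rotz_eq1 Hn /rotz_eq1 Hm]|[Hn Hm]].
  by split; [apply: Hn | apply: Hm].
by congr pair; apply/rotz_eq1.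
Qed.

Lemma torus_unit z : torus z \is a GRing.unit.
Proof.
apply/unitrP; exists (torus (- z)).
by rewrite -!torusD addNr subrr torus0.
Qed.

Lemma torusN z : torus (- z) = (torus z)^-1.
Proof.
apply: (mulrI (torus_unit z)); rewrite -torusD subrr torus0 divrr //.
exact: torus_unit.
Qed.

Lemma eq_torus z w : torus z = torus w <-> torus (z - w) = 1.
Proof.
rewrite torusD torusN; split=> [->|Ezw]; first by rewrite divrr // torus_unit.
by rewrite -[RHS]mul1r -Ezw divrK // torus_unit.
Qed.

Lemma subgroup_pred_torus (H : set ('M[R]_2 * 'M[R]_2)) :
  is_subgroup H -> subgroup_pred (fun z => H (torus z)).
Proof.
move=> sgH; split; first by rewrite torus0; exact: subgroup_1 sgH.
move=> z w Hz Hw; rewrite torusD torusN; apply: (subgroup_M sgH) => //.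
exact: (subgroup_V sgH).
Qed.

Definition cyc (z : int * int) : set ('M[R]_2 * 'M[R]_2) :=
  [set torus (c * z.1, c * z.2) | c in [set: int]].

Lemma is_subgroup_cyc z : is_subgroup (cyc z).
Proof.
split=> [_ [c _ <-]||_ _ [c _ <-] [d _ <-]|_ [c _ <-]].
- exact: torus_unit.
- by exists 0; rewrite // !mul0r torus0.
- by exists (c + d); rewrite // -torusD !mulrDl.
- by exists (- c); rewrite // -torusN !mulNr.
Qed.

Lemma cyc_gen z : cyc z (torus z).
Proof. by exists 1; rewrite // !mul1r -surjective_pairing. Qed.

Lemma cyc_sub H z : is_subgroup H -> H (torus z) -> cyc z `<=` H.
Proof.
move=> /subgroup_pred_torus sgH Hz _ [c _ <-].
by apply: (subgroup_pred_pairM c sgH); rewrite -surjective_pairing.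
Qed.

Lemma cyclic_cyc z : cyclic_group (cyc z).
Proof.
split; first exact: is_subgroup_cyc.
exists (torus z); split; first exact: cyc_gen.
apply/seteqP; split=> [x xz H [sgH /(_ (torus z) erefl) Hz]|x].
  by move: xz; apply: cyc_sub.
by apply; split; [exact: is_subgroup_cyc | move=> _ ->; exact: cyc_gen].
Qed.

Lemma rot_powersE (A B N : nat) : (0 < N)%N ->
    (forall c : int, torus (c * A, c * B) = 1 <-> (N %| c)%Z) ->
  rot_powers R n m A B N = cyc (Posz A, Posz B) /\
  rot_powers R n m A B N #= `I_N.
Proof.
move=> N_gt0 kerN.
have rotE (i : nat) : (rotmx (2 * pi / n%:R * A%:R * i%:R),
   rotmx (2 * pi / m%:R * B%:R * i%:R)) = torus (i%:Z * A, i%:Z * B).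
  rewrite /torus /rotz /= !rmorphM /= -!pmulrn.
  by congr (rotmx _, rotmx _); rewrite mulrAC -!mulrA; congr (_ * (_ * _)); ring.
split.
  apply/seteqP; split=> [_ [i _ <-]|_ [c _ <-]]; first by rewrite rotE; exists i%:Z.
  have N_neq0 : Posz N != 0 by lia.
  have r_ge0 := modz_ge0 c N_neq0; have r_lt := ltz_mod c N_neq0.
  exists `|(c %% N)%Z|%N; first by rewrite /=; lia.
  rewrite rotE gez0_abs //; apply/eq_torus.
  have -> : (((c %% N)%Z * A, (c %% N)%Z * B) - (c * Posz A, c * Posz B)) =
     (((c %% N)%Z - c) * A, ((c %% N)%Z - c) * B) :> (int * int)%type.
    by rewrite !mulrBl.
  by apply/kerN; rewrite -opprB rpredN {1}(divz_eq c N) addrK dvdz_mull.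
apply: inj_card_eq => i j; rewrite !inE /= => lt_i lt_j.
rewrite !rotE => /eq_torus Eij.
have /kerN : torus ((i%:Z - j%:Z) * A, (i%:Z - j%:Z) * B) = 1.
  by rewrite -Eij !mulrBl.
case/dvdzP=> q Eq.
have [q0|] := eqVneq q 0; first by move: Eq; rewrite q0 mul0r; lia.
nia.
Qed.

Lemma cyc_direct_product (H : set ('M[R]_2 * 'M[R]_2)) (g h : int * int) :
    is_subgroup H -> H (torus g) -> H (torus h) ->
    (forall x, H x -> exists c d : int,
      x = torus (c * g.1 + d * h.1, c * g.2 + d * h.2)) ->
    (forall c d : int, torus (c * g.1 + d * h.1, c * g.2 + d * h.2) = 1 ->
      torus (c * g.1, c * g.2) = 1) ->
  internal_direct_product H (cyc g) (cyc h).
Proof.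
move=> sgH Hg Hh spanH indep.
have torusDM c d : torus (c * g.1 + d * h.1, c * g.2 + d * h.2) =
    torus (c * g.1, c * g.2) * torus (d * h.1, d * h.2).
  by rewrite -torusD.
split; try exact: is_subgroup_cyc.
- by move=> _ _ [c _ <-] [d _ <-]; rewrite -!torusD addrC.
- apply/seteqP; split=> [_ [[c _ <-] [d _ Ed]]|_ ->]; last first.
    by split; apply: subgroup_1; exact: is_subgroup_cyc.
  apply: (indep c (- d)); rewrite torusDM !mulNr -Ed -torusD -torus0.
  by congr torus; congr pair; exact: subrr.
- apply/seteqP; split=> [x /spanH[c [d ->]]|_ [x [y [gx hy ->]]]].
    by rewrite torusDM; do 2!eexists; split; [exists c | exists d |].
  by apply: (subgroup_M sgH); [apply: cyc_sub gx | apply: cyc_sub hy].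
Qed.

(** If K2 were 1, the second generator would be trivial and H cyclic.  As K2
divides K1, the vector g1 + g2 has the same order as g1 and also meets the
group of g2 trivially; but it does not lie in the group of g1, so it gives a
different decomposition. *)
Lemma cyc_decomposition (H : set ('M[R]_2 * 'M[R]_2)) (A1 B1 A2 B2 K1 K2 : nat) :
    is_subgroup H ->
    (forall x, H x <-> exists c d : int,
      x = torus (c * Posz A1 + d * Posz A2, c * Posz B1 + d * Posz B2)) ->
    (forall c d : int,
      torus (c * Posz A1 + d * Posz A2, c * Posz B1 + d * Posz B2) = 1 <->
      (K1 %| c)%Z /\ (K2 %| d)%Z) ->
    (0 < K1)%N -> (0 < K2)%N -> (K2 %| K1)%N -> ~ cyclic_group H ->
  let C1 := rot_powers R n m A1 B1 K1 in
  let C2 := rot_powers R n m A2 B2 K2 in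
  (1 < K2)%N /\
  [/\ C1 #= `I_K1, C2 #= `I_K2, cyclic_group C1, cyclic_group C2 &
      internal_direct_product H C1 C2 /\
      exists D1 D2, cyclic_group D1 /\ cyclic_group D2 /\
        internal_direct_product H D1 D2 /\
        ~ ((D1 = C1 /\ D2 = C2) \/ (D1 = C2 /\ D2 = C1))].
Proof.
move=> sgH spanH kerH K1_gt0 K2_gt0 K21 noncyclic C1 C2.
pose g1 : int * int := (Posz A1, Posz B1); pose g2 : int * int := (Posz A2, Posz B2).
have ker1 (c : int) : torus (c * Posz A1, c * Posz B1) = 1 <-> (K1 %| c)%Z.
  have := kerH c 0; rewrite !mul0r !addr0 => -[kerc kerc'].
  by split=> [/kerc[]//|Kc]; apply: kerc'; rewrite dvdz0.
have ker2 (d : int) : torus (d * Posz A2, d * Posz B2) = 1 <-> (K2 %| d)%Z.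
  have := kerH 0 d; rewrite !mul0r !add0r => -[kerd kerd'].
  by split=> [/kerd[]//|Kd]; apply: kerd'; rewrite dvdz0.
have [C1E C1_card] := rot_powersE K1_gt0 ker1.
have [C2E C2_card] := rot_powersE K2_gt0 ker2.
have Hg1 : H (torus g1) by apply/spanH; exists 1, 0; rewrite !mul1r !mul0r !addr0.
have Hg2 : H (torus g2) by apply/spanH; exists 0, 1; rewrite !mul1r !mul0r !add0r.
have K2_gt1 : (1 < K2)%N.
  rewrite ltnNge; apply/negP => le_K2_1; have K2_1 : K2 = 1%N by lia.
  apply: noncyclic; rewrite (_ : H = cyc g1); first exact: cyclic_cyc.
  apply/seteqP; split; last exact: cyc_sub.
  move=> x /spanH[c [d ->]]; exists c => //; apply/eq_torus.
  have /ker2 : (K2 %| - d)%Z by rewrite K2_1 dvd1z.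
  by move=> <-; congr torus; congr pair; rewrite /= mulNr; lia.
split=> //; rewrite /C1 /C2 C1E C2E.
split; [by rewrite -C1E|by rewrite -C2E|exact: cyclic_cyc|exact: cyclic_cyc|split].
  apply: cyc_direct_product => // [x /spanH//|c d /kerH[Kc _]].
  exact/ker1.
(* If g were in the group of g1, or g2 in it, then K2 would divide 1. *)
pose g : int * int := (Posz A1 + Posz A2, Posz B1 + Posz B2).
have not_1 (c : int) : torus (c * Posz A1 + 1 * Posz A2, c * Posz B1 + 1 * Posz B2) <> 1.
  by move=> /kerH[_]; rewrite dvdz1 /=; lia.
exists (cyc g), (cyc g2); split; first exact: cyclic_cyc.
split; first exact: cyclic_cyc.
split.
  apply: cyc_direct_product => //.
  - by apply/spanH; exists 1, 1; rewrite !mul1r.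
  - move=> x /spanH[c [d ->]]; exists c, (d - c).
    by congr torus; congr pair => /=; ring.
  - move=> c d /= Ecd; have [Kc _] : (K1 %| c)%Z /\ (K2 %| c + d)%Z.
      by apply/kerH; rewrite -Ecd; congr torus; congr pair; ring.
    rewrite (_ : (_, _) = (c * Posz A1 + c * Posz A2, c * Posz B1 + c * Posz B2)).
      by apply/kerH; split=> //; apply: dvdz_trans Kc.
    by congr pair; ring.
case=> -[Eg Eg2].
  have := cyc_gen g; rewrite Eg => -[c _ /esym/eq_torus Ec].
  by apply: (@not_1 (1 - c)); rewrite -Ec; congr torus; congr pair => /=; ring.
have := cyc_gen g2; rewrite Eg2 => -[c _ /esym/eq_torus Ec].
by apply: (@not_1 (- c)); rewrite -Ec; congr torus; congr pair => /=; ring.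
Qed.

End Torus.
End Rotation.

(** * Parameters from block data *)

Section Blocks.
Set Implicit Arguments. Unset Strict Implicit.
Local Open Scope nat_scope.
Variables (n m : nat) (F : factorization n m).
Variables (bl k l w : 'I_(fs F) -> nat) (g : {perm 'I_(fs F)}).
Hypothesis bl_lt8 : forall j, bl j < 8.
Let cnt c := #|[pred j | bl j < c]|.
Hypothesis gP : forall (i : 'I_(fs F)) c, (i < cnt c) = (bl (g i) < c).

(** The numbers of indices per block are written as differences of the
cumulative counts, so that the bounds N_1, ..., N_8 telescope to the latter. *)
Definition block_params : params F :=
  @Params n m F (cnt 1) (cnt 2 - cnt 1) (cnt 3 - cnt 2) (cnt 4 - cnt 3)
    (cnt 5 - cnt 4) (cnt 6 - cnt 5) (cnt 7 - cnt 6) (cnt 8 - cnt 7) g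
    (fun i => k (g i)) (fun i => l (g i))
    (fun i => w (g i)) (fun i => w (g i)) (fun i => w (g i)) (fun i => w (g i)).
Local Notation q := block_params.

Let cnt_mono c : cnt c <= cnt c.+1.
Proof. by apply/subset_leq_card/fintype.subsetP=> j; rewrite !inE => /leqW. Qed.

Let block_bounds :
  [/\ N1 q = cnt 1, N2 q = cnt 2, N3 q = cnt 3 & N4 q = cnt 4] /\
  [/\ N5 q = cnt 5, N6 q = cnt 6, N7 q = cnt 7 & N8 q = cnt 8].
Proof.
have := cnt_mono 1; have := cnt_mono 2; have := cnt_mono 3; have := cnt_mono 4.
have := cnt_mono 5; have := cnt_mono 6; have := cnt_mono 7.
by rewrite /N8 /N7 /N6 /N5 /N4 /N3 /N2 /N1 /=; split; split; lia.
Qed.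

Let inblock c (i : 'I_(fs F)) : (cnt c <= i < cnt c.+1) = (bl (g i) == c).
Proof. by rewrite leqNgt !gP -leqNgt ltnS -eqn_leq eq_sym. Qed.

Let sum_block c (f : 'I_(fs F) -> nat) :
  \sum_(i < fs F | bl (g i) == c) f i = \sum_(i < fs F) (bl (g i) == c) * f i.
Proof. by rewrite big_mkcond; apply: eq_bigr => i _; case: eqP; rewrite ?mul1n. Qed.

Let inblock1 (i : 'I_(fs F)) : (i < N1 q) = (bl (g i) == 0).
Proof. by rewrite gP ltnS leqn0. Qed.
Let inblock2 (i : 'I_(fs F)) : (N1 q <= i < N2 q) = (bl (g i) == 1).
Proof. by case: block_bounds => -[-> -> _ _] _; exact: inblock. Qed.
Let inblock3 (i : 'I_(fs F)) : (N2 q <= i < N3 q) = (bl (g i) == 2).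
Proof. by case: block_bounds => -[_ -> -> _] _; exact: inblock. Qed.
Let inblock4 (i : 'I_(fs F)) : (N3 q <= i < N4 q) = (bl (g i) == 3).
Proof. by case: block_bounds => -[_ _ -> ->] _; exact: inblock. Qed.
Let inblock5 (i : 'I_(fs F)) : (N4 q <= i < N5 q) = (bl (g i) == 4).
Proof. by case: block_bounds => -[_ _ _ ->] [-> _ _ _]; exact: inblock. Qed.
Let inblock6 (i : 'I_(fs F)) : (N5 q <= i < N6 q) = (bl (g i) == 5).
Proof. by case: block_bounds => _ [-> -> _ _]; exact: inblock. Qed.
Let inblock7 (i : 'I_(fs F)) : (N6 q <= i < N7 q) = (bl (g i) == 6).
Proof. by case: block_bounds => _ [_ -> -> _]; exact: inblock. Qed.
Let inblock8 (i : 'I_(fs F)) : (N7 q <= i < N8 q) = (bl (g i) == 7).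
Proof. by case: block_bounds => _ [_ _ -> ->]; exact: inblock. Qed.
Let in_N8 (i : 'I_(fs F)) : i < N8 q.
Proof. by case: block_bounds => _ [_ _ _ ->]; rewrite gP. Qed.
Let in_rank2 (i : 'I_(fs F)) : (N4 q <= i < N8 q) = (4 <= bl (g i)).
Proof.
by rewrite in_N8 andbT; case: block_bounds => -[_ _ _ ->] _; rewrite leqNgt gP -leqNgt.
Qed.

Local Notation p := (@fprime n m F).
Local Notation a := (@falpha n m F).
Local Notation b := (@fbeta n m F).

Let cofnE i : cofn q i = cofactor p a (g i).
Proof. by rewrite /cofn /cofactor /pp /pa -falphaE. Qed.
Let cofmE i : cofm q i = cofactor p b (g i).
Proof. by rewrite /cofm /cofactor /pp /pb -fbetaE. Qed.

Let reindex_g (f : 'I_(fs F) -> nat) : \sum_j f j = \sum_i f (g i).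
Proof. exact: (reindex_inj (@perm_inj _ g)). Qed.

Lemma calA1_blocks :
  calA1 q = \sum_j blockA1 (p j) (a j) (k j) (w j) (bl j) * cofactor p a j.
Proof.
rewrite reindex_g /calA1 (eq_bigl _ _ inblock1) (eq_bigl _ _ inblock2)
  (eq_bigl _ _ inblock3) (eq_bigl _ _ inblock4) (eq_bigl _ _ inblock5)
  (eq_bigl _ _ inblock6) (eq_bigl _ _ inblock7) (eq_bigl _ _ inblock8).
rewrite !sum_block -!big_split /=; apply: eq_bigr => i _; rewrite !cofnE.
have := bl_lt8 (g i); case: (bl (g i)) => [|[|[|[|[|[|[|[|]]]]]]]] //= _;
by rewrite ?mul0n ?mul1n ?addn0 ?add0n.
Qed.

Lemma calB1_blocks :
  calB1 q = \sum_j blockB1 (p j) (b j) (k j) (w j) (bl j) * cofactor p b j.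
Proof.
rewrite reindex_g /calB1 (eq_bigl _ _ inblock1) (eq_bigl _ _ inblock2)
  (eq_bigl _ _ inblock3) (eq_bigl _ _ inblock4) (eq_bigl _ _ inblock5)
  (eq_bigl _ _ inblock6) (eq_bigl _ _ inblock7) (eq_bigl _ _ inblock8).
rewrite !sum_block -!big_split /=; apply: eq_bigr => i _; rewrite !cofmE.
have := bl_lt8 (g i); case: (bl (g i)) => [|[|[|[|[|[|[|[|]]]]]]]] //= _;
by rewrite ?mul0n ?mul1n ?addn0 ?add0n.
Qed.

Lemma calA2_blocks :
  calA2 q = \sum_j blockA2 (p j) (a j) (l j) (bl j) * cofactor p a j.
Proof.
rewrite reindex_g /calA2 (eq_bigl _ _ inblock5) (eq_bigl _ _ inblock7).
rewrite !sum_block -!big_split /=; apply: eq_bigr => i _; rewrite !cofnE.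
have := bl_lt8 (g i); case: (bl (g i)) => [|[|[|[|[|[|[|[|]]]]]]]] //= _;
by rewrite ?mul0n ?mul1n ?addn0 ?add0n.
Qed.

Lemma calB2_blocks :
  calB2 q = \sum_j blockB2 (p j) (b j) (l j) (bl j) * cofactor p b j.
Proof.
rewrite reindex_g /calB2 (eq_bigl _ _ inblock6) (eq_bigl _ _ inblock8).
rewrite !sum_block -!big_split /=; apply: eq_bigr => i _; rewrite !cofmE.
have := bl_lt8 (g i); case: (bl (g i)) => [|[|[|[|[|[|[|[|]]]]]]]] //= _;
by rewrite ?mul0n ?mul1n ?addn0 ?add0n.
Qed.

Hypothesis blP : forall j, block_ok (p j) (a j) (b j) (k j) (l j) (w j) (bl j).

Lemma block_l_eq0 j : bl j < 4 -> l j = 0.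
Proof. by have := blP j; case: (bl j) => [|[|[|[|?]]]] //= []. Qed.

Lemma card_C1_blocks : card_C1 q = \prod_j p j ^ k j.
Proof.
rewrite (reindex_inj (@perm_inj _ g)) /card_C1.
by apply: eq_bigl => i; rewrite in_N8.
Qed.

Lemma card_C2_blocks : card_C2 q = \prod_j p j ^ l j.
Proof.
rewrite (reindex_inj (@perm_inj _ g)) /card_C2 (eq_bigl _ _ in_rank2) big_mkcond /=.
by apply: eq_bigr => i _; case: leqP => // /block_l_eq0->.
Qed.

Lemma block_params_admissible (t := Ordinal (fs_gt0 F)) :
    [/\ bl t = 0, 0 < k t & odd (w t)] -> (exists j, 4 <= bl j) ->
  admissible q.
Proof.
move=> [bl_t k_t w_t] [j bl_j].
have lt_leB1 x y : x < y -> x <= y - 1 by lia.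
have pre i : exists i', g i' = i by exists ((g^-1)%g i); rewrite permKV.
split.
- case: block_bounds => _ [_ _ _ ->]; rewrite -[X in _ <= X]card_ord; exact: max_card.
- have [i gi] := pre t; exists i; rewrite inblock1 /pp /= gi bl_t.
  by split=> //; exact: fprime_2.
- move=> i; rewrite inblock1 /pp /pa /pb /= => /eqP bl0.
  rewrite -(fprime_2 F) => /fprime_inj gi; move: (blP (g i)); rewrite bl0 gi /= => -[? lt_w _].
  rewrite fprime_2 in lt_w *.
  have := odd_gt0 w_t; rewrite /t => w_gt0.
  split; [by apply/andP | lia | move=> c _ Ew; move: w_t; rewrite Ew oddM andbF //].
- move=> i; rewrite inblock1 /pp /pa /pb /= => /eqP bl0 _.
  by move: (blP (g i)); rewrite bl0 /= => -[? /lt_leB1 ? _].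
- by move=> i; rewrite inblock2 => /eqP bli; move: (blP (g i)); rewrite bli => -[? /lt_leB1 ? _].
- by move=> i; rewrite inblock3 => /eqP bli; move: (blP (g i)); rewrite bli => -[? /lt_leB1 ? _].
- by move=> i; rewrite inblock4 => /eqP bli; move: (blP (g i)); rewrite bli => -[? /lt_leB1 ? _].
- by move=> i; rewrite inblock5 => /eqP bli; move: (blP (g i)); rewrite bli => -[? ? /lt_leB1 ?].
- by move=> i; rewrite inblock6 => /eqP bli; move: (blP (g i)); rewrite bli => -[? ? /lt_leB1 ?].
- by move=> i; rewrite inblock7 => /eqP bli; move: (blP (g i)); rewrite bli => -[? ? /lt_leB1 ?].
- by move=> i; rewrite inblock8 => /eqP bli; move: (blP (g i)); rewrite bli => -[? ? /lt_leB1 ?].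
have [i gi] := pre j; exists i; rewrite in_rank2 gi; split=> //.
have := blP j; rewrite /pa /pb /= gi; case: (bl j) bl_j => [|[|[|[|[|[|[|[|]]]]]]]] //= _ [].
- by move=> /andP[l_gt0 le_lk]; rewrite leq_min => /andP[le_ka le_kb] _; nia.
- by move=> /andP[l_gt0 le_lk]; rewrite leq_min => /andP[le_ka le_kb] _; nia.
- by move=> ? ? _; nia.
- by move=> ? ? _; nia.
Qed.

End Blocks.

(** * Groups of class E_1 *)

Section Final.
Set Implicit Arguments. Unset Strict Implicit.
Import Order.TTheory GRing.Theory Num.Theory.
Local Open Scope classical_set_scope.
Local Open Scope card_scope.
Local Open Scope ring_scope.
Variables (R : realType) (n m : nat) (F : factorization n m).
Hypotheses (n_gt0 : (0 < n)%N) (m_gt0 : (0 < m)%N).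
Variable (C : set ('M[R]_2 * 'M[R]_2)).
Hypothesis C_E1 : class_E1 n m C.

Local Notation p := (@fprime n m F).
Local Notation a := (@falpha n m F).
Local Notation b := (@fbeta n m F).
Local Notation torus := (@torus R n m).

Let sgC := E1_subgroup C_E1.
Let H (z : int * int) := C (torus z).
Let sgH : subgroup_pred H := subgroup_pred_torus n m sgC.

Lemma E1_torus x : C x -> exists2 z, H z & x = torus z.
Proof.
move=> Cx; have [[r _ Er] [t _ Et]] := E1_sub C_E1 Cx.
have Ex : x = torus (r%:Z, t%:Z) by rewrite [x]surjective_pairing -Er -Et.
by exists (r%:Z, t%:Z); rewrite /H -?Ex.
Qed.

Lemma E1_dvd x y : (n %| x)%Z -> (m %| y)%Z -> H (x, y).
Proof.
move=> dvd_x dvd_y; rewrite /H (_ : torus _ = 1); first exact: subgroup_1 sgC.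
exact/torus_eq1.
Qed.

Lemma rotz_half N h : (0 < N)%N -> N = (h * 2)%N -> rotz R N h = - 1.
Proof.
move=> N_gt0 EN; rewrite -(rotmx_pi R) /rotz EN -pmulrn; congr rotmx.
have h_neq0 : h%:R != 0 :> R by rewrite pnatr_eq0; lia.
by rewrite natrM; field.
Qed.

(** As C contains (-I, -I), membership of (-I, I) or of (I, -I) would give it all
four elements of the Klein group; this is what restricts the component at 2. *)
Lemma E1_local_blocks : exists bl k l w : 'I_(fs F) -> nat,
  [/\ forall j, block_ok (p j) (a j) (b j) (k j) (l j) (w j) (bl j),
      forall i (x y : int), H (x * cofactor p a i, y * cofactor p b i) <->
        exists c d : int,
        ((p i ^ a i)%N %| x - (c * blockA1 (p i) (a i) (k i) (w i) (bl i)
                             + d * blockA2 (p i) (a i) (l i) (bl i)))%Z /\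
        ((p i ^ b i)%N %| y - (c * blockB1 (p i) (b i) (k i) (w i) (bl i)
                             + d * blockB2 (p i) (b i) (l i) (bl i)))%Z &
      let t := Ordinal (fs_gt0 F) in [/\ bl t = 0, 0 < k t & odd (w t)]%N].
Proof.
pose Hi i (z : int * int) := H (z.1 * cofactor p a i, z.2 * cofactor p b i).
have sgHi i : subgroup_pred (Hi i).
  split; first by rewrite /Hi !mul0r; exact: (subgroup_pred0 sgH).
  move=> z z' Hz Hz'; have := subgroup_predB sgH Hz Hz'.
  by congr H; congr pair; rewrite /= mulrBl.
have Ea i : (p i ^ a i * cofactor p a i)%N = n.
  by rewrite mulnC (cofactorK (@fprime_prime _ _ F)) -falphaE.
have Eb i : (p i ^ b i * cofactor p b i)%N = m.
  by rewrite mulnC (cofactorK (@fprime_prime _ _ F)) -fbetaE.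
have Hia i : Hi i ((p i ^ a i)%N : int, 0).
  by apply: E1_dvd; rewrite /= ?mul0r ?dvdz0 // -PoszM Ea dvdzz.
have Hib i : Hi i (0, (p i ^ b i)%N : int).
  by apply: E1_dvd; rewrite /= ?mul0r ?dvdz0 // -PoszM Eb dvdzz.
have /choice[bl /choice[k /choice[l /choice[w blP]]]] i :=
  local_classification (fprime_prime i) (sgHi i) (Hia i) (Hib i).
exists bl, k, l, w; split=> [j|i x y|t]; [by case: (blP j)|by case: (blP i) => _; exact|].
have [ok span] := blP t; have a_t := falpha_gt0 F; have b_t := fbeta_gt0 F.
have En : n = (2 ^ (a t - 1) * cofactor p a t * 2)%N.
  rewrite mulnAC -expnSr subn1 prednK // -[LHS](Ea t); congr (_ ^ _ * _)%N.
  exact: fprime_2.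
have Em : m = (2 ^ (b t - 1) * cofactor p b t * 2)%N.
  rewrite mulnAC -expnSr subn1 prednK // -[LHS](Eb t); congr (_ ^ _ * _)%N.
  exact: fprime_2.
move: ok span (Hia t) (Hib t); rewrite (fprime_2 F : p t = 2%N) => ok span Ha2 Hb2.
have CN : C (- 1, - 1) := E1_center C_E1.
have CMN x : C x -> C (x * (- 1, - 1)) by move=> Cx; apply: subgroup_M CN.
have mN (x y : 'M[R]_2) : (x, y) * (- 1, - 1) = (- x, - y) :> 'M[R]_2 * 'M[R]_2.
  by congr pair; rewrite mulrN mulr1.
apply: (block_at_two a_t b_t ok (sgHi t) Ha2 Hb2 span).
- rewrite /Hi /H /torus /= -!PoszM (rotz_half n_gt0 En) (rotz_half m_gt0 Em).
  exact: E1_center C_E1.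
- rewrite /Hi /H /torus /= mul0r -!PoszM (rotz_half n_gt0 En) rotz0 => C1.
  apply: (E1_klein C_E1) => _ [[[->|->]|->]|->] //; first exact: subgroup_1 sgC.
  by have := CMN _ C1; rewrite mN opprK.
- rewrite /Hi /H /torus /= mul0r -!PoszM (rotz_half m_gt0 Em) rotz0 => C1.
  apply: (E1_klein C_E1) => _ [[[->|->]|->]|->] //; first exact: subgroup_1 sgC.
  by have := CMN _ C1; rewrite mN opprK.
Qed.

End Final.

Local Open Scope classical_set_scope.
Local Open Scope card_scope.

Theorem theorem9 (R : realType) (n m : nat)
    (n_gt0 : (0 < n)%N) (m_gt0 : (0 < m)%N)
    (n_even : ~~ odd n) (m_even : ~~ odd m)
    (F : factorization n m)
    (C : set ('M[R]_2 * 'M[R]_2))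
    (C_E1 : class_E1 n m C) (C_two : two_generators C) :
  exists (q : params F) (C1 C2 : set ('M[R]_2 * 'M[R]_2)),
    admissible q /\
    C1 = rot_powers R n m (calA1 q) (calB1 q) (card_C1 q) /\
    C2 = rot_powers R n m (calA2 q) (calB2 q) (card_C2 q) /\
    C1 #= `I_(card_C1 q) /\ C2 #= `I_(card_C2 q) /\
    cyclic_group C1 /\ cyclic_group C2 /\
    internal_direct_product C C1 C2 /\
    exists D1 D2 : set ('M[R]_2 * 'M[R]_2),
      cyclic_group D1 /\ cyclic_group D2 /\
      internal_direct_product C D1 D2 /\
      ~ ((D1 = C1 /\ D2 = C2) \/ (D1 = C2 /\ D2 = C1)).
Proof.
have [bl [k [l [w [blP local_span two_block]]]]] := E1_local_blocks F n_gt0 m_gt0 C_E1.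
have p_prime := @fprime_prime _ _ F; have p_inj := @fprime_inj _ _ F.
have bl_lt8 j : (bl j < 8)%N.
  by have := blP j; case: (bl j) => [|[|[|[|[|[|[|[|?]]]]]]]].
have [g gP] := sorting_perm bl.
pose q := block_params bl k l w g.
have sgC := E1_subgroup C_E1; have sgH := subgroup_pred_torus n m sgC.
set K1 := card_C1 q; set K2 := card_C2 q.
set A1 := calA1 q; set B1 := calB1 q; set A2 := calA2 q; set B2 := calB2 q.
have span (x y : int) : C (torus R n m (x, y)) <-> exists c d : int,
   ((n %| x - (c * Posz A1 + d * Posz A2))%Z /\ (m %| y - (c * Posz B1 + d * Posz B2))%Z)%R.
  rewrite /A1 /A2 /B1 /B2 calA1_blocks // calA2_blocks // calB1_blocks // calB2_blocks //.
  have := subgroup_glue p_prime p_inj sgH _ _ local_span x y.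
  rewrite -falphaE -fbetaE; apply.
    by apply: (E1_dvd n_gt0 m_gt0 C_E1); rewrite ?dvdz0 ?dvdzz.
  by apply: (E1_dvd n_gt0 m_gt0 C_E1); rewrite ?dvdz0 ?dvdzz.
have ker (c d : int) :
    (torus R n m (c * Posz A1 + d * Posz A2, c * Posz B1 + d * Posz B2) = 1)%R <->
    (K1 %| c)%Z /\ (K2 %| d)%Z.
  rewrite torus_eq1 //= /A1 /A2 /B1 /B2 /K1 /K2.
  rewrite calA1_blocks // calA2_blocks // calB1_blocks // calB2_blocks //.
  rewrite (card_C1_blocks _ _ _ bl_lt8) // (card_C2_blocks bl_lt8) //.
  have indep i := block_independent c d (p_prime i) (blP i).
  have glueA := glue_dvd p_prime p_inj (@falpha _ _ F).
  have glueB := glue_dvd p_prime p_inj (@fbeta _ _ F).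
  rewrite -falphaE in glueA; rewrite -fbetaE in glueB.
  rewrite glueA glueB !(dvdz_ppow p_prime p_inj).
  split=> [[Da Db]|[Dk Dl]].
    by split=> i; case: (indep i) => /(_ (conj (Da i) (Db i))) [].
  by split=> i; case: (indep i) => _ /(_ (conj (Dk i) (Dl i))) [].
have le_lk j : (l j <= k j)%N.
  by have := blP j; case: (bl j) => [|[|[|[|[|[|[|[|?]]]]]]]] //= []; clear; lia.
have K2_dvd_K1 : (K2 %| K1)%N.
  rewrite /K1 /K2 (card_C1_blocks _ _ _ bl_lt8) // (card_C2_blocks bl_lt8) //.
  by apply: (big_ind2 (fun x y => x %| y)%N) => // *; [apply: dvdn_mul | apply: dvdn_exp2l].
have K_gt0 e (P : pred 'I_(fs F)) : (0 < \prod_(i < fs F | P i) pp q i ^ e i)%N.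
  by apply: prodn_cond_gt0 => i _; rewrite expn_gt0 prime_gt0 // /pp.
have [|K2_gt1 [C1_card C2_card cycC1 cycC2 [C12 [D1 [D2 D12]]]]] :=
  cyc_decomposition n_gt0 m_gt0 sgC _ ker (K_gt0 _ _) (K_gt0 _ _) K2_dvd_K1 C_two.2.
  move=> x; split=> [Cx|[c [d ->]]]; last first.
    by apply/span; exists c, d; rewrite !GRing.subrr !dvdz0.
  have [[u v] Huv Ex] := E1_torus C_E1 Cx; have [c [d [Du Dv]]] := (span u v).1 Huv.
  exists c, d; rewrite Ex; apply/eq_torus/torus_eq1 => //.
have adm_q : admissible q.
  apply: (block_params_admissible bl_lt8 gP blP two_block).
  apply: contrapT => no_rank2; move: K2_gt1.
  rewrite /K2 (card_C2_blocks bl_lt8) // big1 // => j _.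
  rewrite (block_l_eq0 blP) ?expn0 // ltnNge; apply/negP => le4; apply: no_rank2.
  by exists j.
exists q, (rot_powers R n m A1 B1 K1), (rot_powers R n m A2 B2 K2).
by do ![split=> //]; exists D1, D2.
Qed.
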